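(* Let $n\ge1$ and $t\ge0$, and let $(\pi(t))_{t\ge0}$ be the continuous-time interchange process on the complete graph on $n$ vertices. Let $$m_n^2(t)=\frac{\mathbb{E}\big(\big(\sum_{k=1}^n k^2\alpha_k(\pi(t))\big)2^{\alpha(\pi(t))}\big)}{\mathbb{E}(2^{\alpha(\pi(t))})}.$$ Then $$m_n^2(t)=n\,\frac{\sum_{k=1}^{n}\sum_{b=0}^{\lfloor (n-k)/2\rfloor}k\,\psi(b,k,t)}{\sum_{k=1}^{n}\sum_{b=0}^{\lfloor (n-k)/2\rfloor}\psi(b,k,t)},$$ where, writing $a=n-k-b$ and $y=e^{-tk}$, $\psi$ is defined for $b>0$ by \begin{align*} \psi(b,k,t)&=(a+1-b)\binom{n}{k-1,a+1,b}e^{-t(ab+b)}\Big[\frac{(a+1-b)\,y^{a+b+2}(1-y)^{k-1}}{k}\\ &\quad+y^{b}(a+1-b+k)\int_y^1x^{a+1}(1-x)^{k-1}\,dx+y^{a+1}(a+1-b-k)\int_y^1x^{b}(1-x)^{k-1}\,dx\Big], \end{align*} and for $b=0$ by $$\psi(0,k,t)=(a+1)\binom{n}{k}\Big[y^{n-k+1}(1-y)^{k-1}+k\int_y^1x^{n-k}(1-x)^{k-1}\,dx\Big].$$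
   Context: The interchange process on the complete graph on $\{1,\dots,n\}$ is the continuous-time random walk $(\pi(t))_{t\ge0}$ on the symmetric group $\mathrm{Sym}_n$ started at the identity: each unordered pair $\{i,j\}$, $i\ne j$, carries an independent Poisson clock of rate $1$, and when the clock of $\{i,j\}$ rings the current permutation $\pi$ is replaced by $(ij)\pi$. For a permutation $\pi$, $\alpha_k(\pi)$ is the number of cycles of length $k$ in $\pi$ (fixed points are cycles of length 1), and $\alpha(\pi)=\sum_k\alpha_k(\pi)$ is the total number of cycles. The symbol $\binom{n}{k-1,a+1,b}=\frac{n!}{(k-1)!\,(a+1)!\,b!}$ is the multinomial coefficient (note $(k-1)+(a+1)+b=n$). *)

(* Defs.v *)
From HB Require Import structures.
From mathcomp Require Import all_boot all_order all_algebra all_fingroup.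
From mathcomp Require Import all_classical all_reals all_analysis.

Set Implicit Arguments.
Unset Strict Implicit.
Unset Printing Implicit Defensive.

Import Order.TTheory GRing.Theory Num.Theory.
Import numFieldNormedType.Exports.

Local Open Scope classical_set_scope.
Local Open Scope ring_scope.

(* Mutual independence of a finite family of collections of events. *)
Definition mutually_independent (R : realType) (d : measure_display)
    (T : measurableType d) (P : probability T R) (I : finType)
    (F : I -> set (set T)) : Prop :=
  forall (J : {set I}) (A : I -> set T), (forall i, i \in J -> F i (A i)) ->
    P [set w | forall i, i \in J -> A i w] = (\prod_(i in J) P (A i))%E.

(* The sigma-algebra generated by the variables N t, t >= 0. *)
Definition process_sigma (R : realType) (T : Type) (N : R -> T -> nat) :
    set (set T) :=
  <<s \bigcup_(t in [set t : R | 0 <= t])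
        preimage_set_system setT (N t) measurable >>.

(* Processes are indexed by R, but only their values at times t >= 0 matter. *)
Record poisson_process (R : realType) (d : measure_display)
    (T : measurableType d) (P : probability T R) (rate : R)
    (N : R -> T -> nat) : Prop := {
  poisson_measurable : forall t, 0 <= t -> measurable_fun setT (N t);
  poisson_start : forall w, N 0 w = 0%N;
  poisson_mono : forall w s t, 0 <= s -> s <= t -> (N s w <= N t w)%N;
  poisson_rcont : forall w t, 0 <= t -> \forall u \near t^'+, N u w = N t w;
  poisson_indep_increments : forall (m : nat) (tau : nat -> R),
    0 <= tau 0%N -> (forall i, (i < m)%N -> tau i <= tau i.+1) ->
    mutually_independent P (fun i : 'I_m =>
      preimage_set_system setT
        (fun w => (N (tau i.+1) w - N (tau i) w)%N) measurable);
  (* s < t is strict because poisson_pmf 0 is not the Dirac mass at 0 *)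
  poisson_increment_law : forall s t k, 0 <= s -> s < t ->
    P [set w | (N t w - N s w)%N = k] = (poisson_pmf (rate * (t - s)) k)%:E }.

(* The clock with counting process N (number of rings in ]0, t]) rings at t. *)
Definition rings (R : realType) (T : Type) (N : R -> T -> nat) (t : R) (w : T)
    : Prop :=
  0 < t /\ forall s, 0 <= s -> s < t -> (N s w < N t w)%N.

(* Unordered pairs {i, j} with i != j, represented by i < j. *)
Definition edge (n : nat) : finType := {e : 'I_n * 'I_n | (e.1 < e.2)%N}.

Definition transposition (n : nat) (e : edge n) : 'S_n :=
  tperm (val e).1 (val e).2.

(* Products in 'S_n compose from left to right: (p * q) x = q (p x); hence the
   composition "(i j) after pi" is written pi * (i j). Simultaneous rings of two
   clocks, a null event, leave the jump unconstrained. *)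
Record driven_by_clocks (R : realType) (d : measure_display)
    (T : measurableType d) (P : probability T R) (n : nat)
    (N : edge n -> R -> T -> nat) (pi : R -> T -> 'S_n) : Prop := {
  clocks_poisson : forall e, poisson_process P 1 (N e);
  clocks_indep : mutually_independent P (fun e => process_sigma (N e));
  pi_measurable : forall t s, 0 <= t -> measurable [set w | pi t w = s];
  pi_start : forall w, pi 0 w = 1%g;
  pi_constant : forall w s t, 0 <= s -> s <= t ->
    (forall e u, s < u -> u <= t -> ~ rings (N e) u w) -> pi t w = pi s w;
  pi_jump : forall w t e, rings (N e) t w ->
    (forall f, f != e -> ~ rings (N f) t w) ->
    \forall s \near t^'-, pi t w = (pi s w * transposition e)%g }.

Definition interchange_process (R : realType) (d : measure_display)
    (T : measurableType d) (P : probability T R) (n : nat)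
    (pi : R -> T -> 'S_n) : Prop :=
  exists N : edge n -> R -> T -> nat, driven_by_clocks P N pi.

Definition alpha_ (n : nat) (k : nat) (p : 'S_n) : nat :=
  #|[set C in porbits p | #|C| == k]|.

Definition alpha (n : nat) (p : 'S_n) : nat :=
  (\sum_(1 <= k < n.+1) alpha_ k p)%N.

(* The superscript 2 of m_n^2 is part of its name, not a power. *)
Definition m2 (R : realType) (d : measure_display) (T : measurableType d)
    (P : probability T R) (n : nat) (pi : R -> T -> 'S_n) (t : R) : R :=
  fine (expectation P (fun w =>
    (\sum_(1 <= k < n.+1) k%:R ^+ 2 * (alpha_ k (pi t w))%:R)
    * 2 ^+ alpha (pi t w)))
  / fine (expectation P (fun w => 2 ^+ alpha (pi t w))).

Definition inc_beta (R : realType) (y : R) (p q : nat) : R :=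
  \int[lebesgue_measure]_(x in `[y, 1]) (x ^+ p * (1 - x) ^+ q).

Definition multinomial3 (R : realType) (n p q r : nat) : R :=
  n`!%:R / (p`!%:R * q`!%:R * r`!%:R).

Definition psi (R : realType) (n b k : nat) (t : R) : R :=
  let a := (n - k - b)%N in
  let y := expR (- (t * k%:R)) in
  let c : R := a%:R + 1 - b%:R in
  if b == 0%N then
    (a%:R + 1) * 'C(n, k)%:R *
    (y ^+ (n - k + 1)%N * (1 - y) ^+ k.-1
     + k%:R * inc_beta y (n - k) k.-1)
  else
    c * multinomial3 R n k.-1 a.+1 b * expR (- (t * (a * b + b)%N%:R)) *
    (c * y ^+ (a + b + 2)%N * (1 - y) ^+ k.-1 / k%:R
     + y ^+ b * (c + k%:R) * inc_beta y a.+1 k.-1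
     + y ^+ a.+1 * (c - k%:R) * inc_beta y b k.-1).

(* Main.v *)
(* Attach to a permutation the product over its cycles, m being the length of a
   cycle, of p_m = x1^m + x2^m + w^m - 1: a supercharacter of gl(3|1) with the odd
   variable set to 1.  By the cut-and-join identity the generator of the process
   acts on it as a second order differential operator in x1, x2, w, which becomes
   free after multiplication by the super Vandermonde
     (x1 - x2) (x1 - w) (x2 - w) / ((1 - x1) (1 - x2) (w - 1)).
   Hence the coefficient of x1^(a+1) x2^b, a polynomial in w, evolves by the factor
   e^(-t(ab+b)) y^(n+1) and the substitution of w/y for w, where k = n - a - b and
   y = e^(-tk).  At w = 1 this coefficient counts the k-cycles, weighted by 2 to the
   number of the other cycles.  At time 0 it comes from (x1 + x2 + w - 1)^n, whose
   partial binomial sums at w = 1/y are incomplete beta integrals.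
   The law of the process is the limit of the discrete walks that see at most one
   ring in each interval of a grid of [0, t]. *)

From HB Require Import structures.
Require Import Defs.
From mathcomp Require Import all_boot all_order all_algebra all_fingroup.
From mathcomp Require Import all_classical all_reals all_analysis.
From mathcomp Require Import measurable_realfun.
From mathcomp Require Import ring lra zify.

Set Implicit Arguments.
Unset Strict Implicit.
Unset Printing Implicit Defensive.

Import Order.TTheory GRing.Theory Num.Theory.
Import numFieldNormedType.Exports.

Local Open Scope ring_scope.

(** * Formal power series *)

(** Why an odd variable: at w = 1 it cancels w, and [p_m] becomes [x1^m + x2^m], whose value 2 at x1
    = x2 = 1 is the weight of a cycle. A first derivative in w replaces one factor by its length m
    and so marks one cycle. The super Vandermonde has a simple pole at w = 1, while everything else
    vanishes there in the degrees that matter; the value of the quotient at w = 1 is therefore this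
    derivative. The factor [a + 1 - b] of psi leads from coefficients back to values at x1 = x2 = 1:
    it is the value at (1, 1) of the Schur polynomial with rows a and b, and the coefficients of
    [(x1 - x2) f], for f symmetric, are the multiplicities of these polynomials in f. Hence also the
    range [b <= (n - k) / 2]. The obstacle is the pole. As power series 1 - x1 and 1 - x2 are
    invertible, but the coefficients have to stay polynomials in w, to be evaluated at 1 and at 1/y.
    The factor 1/(w - 1) is thus left out at first, and the division is made coefficient by
    coefficient. Denominator and factor n both come from [sum_k k alpha_k = n]: the expectations of
    [k alpha_k 2^alpha] determine that of [2^alpha]. *)

Section PowerSeries.
Variable K : comNzRingType.

(* A type of its own, because [nat -> K] carries the pointwise product. *)
Definition pser : Type := nat -> K.

HB.instance Definition _ := GRing.Zmodule.copy pser (nat -> K).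

Definition pser_one : pser := fun i => (i == 0%N)%:R.
Definition pser_mul (f g : pser) : pser :=
  fun n => \sum_(i < n.+1) f i * g (n - i)%N.

Let trunc n (f : pser) : {poly K} := \poly_(i < n.+1) f i.

(** Coefficients up to [n] of a product only see the truncations at [n], so commutativity and
    associativity descend from polynomials. *)
Let pser_mul_trunc n m f g :
  (m <= n)%N -> pser_mul f g m = (trunc n f * trunc n g)`_m.
Proof.
move=> mn; rewrite coefM; apply: eq_bigr => i _.
by rewrite !coef_poly !ltnS (leq_trans (leq_ord i) mn) (leq_trans (leq_subr _ _) mn).
Qed.

Let pser_mulC : commutative pser_mul.
Proof.
move=> f g; apply/funext => n.
by rewrite !(pser_mul_trunc _ _ (leqnn n)) mulrC.
Qed.

Let pser_mulA : associative pser_mul.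
Proof.
move=> f g h; apply/funext => n.
have -> : pser_mul f (pser_mul g h) n = (trunc n f * (trunc n g * trunc n h))`_n.
  rewrite coefM; apply: eq_bigr => i _.
  by rewrite coef_poly ltn_ord (@pser_mul_trunc n) // leq_subr.
rewrite mulrA coefM; apply: eq_bigr => i _.
by rewrite [(trunc n h)`_ _]coef_poly ltnS leq_subr (@pser_mul_trunc n) // leq_ord.
Qed.

Let pser_mul1 : left_id pser_one pser_mul.
Proof.
move=> f; apply/funext => n; rewrite /pser_mul big_ord_recl /= subn0 mul1r.
by rewrite big1 ?addr0 // => i _; rewrite mul0r.
Qed.

Let pser_mulDl : left_distributive pser_mul +%R.
Proof.
move=> f g h; apply/funext => n; rewrite /pser_mul.
rewrite -[RHS]/(pser_mul f h n + pser_mul g h n) /pser_mul -big_split /=.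
by apply: eq_bigr => i _; rewrite -mulrDl.
Qed.

Let pser_one_neq0 : pser_one != 0.
Proof.
by apply/eqP => /(congr1 (fun f : pser => f 0%N)) /eqP; rewrite oner_eq0.
Qed.

HB.instance Definition _ := GRing.Zmodule_isComNzRing.Build pser
  pser_mulA pser_mulC pser_mul1 pser_mulDl pser_one_neq0.

Lemma pserME (f g : pser) n : (f * g) n = \sum_(i < n.+1) f i * g (n - i)%N.
Proof. by []. Qed.
Lemma pserDE (f g : pser) n : (f + g) n = f n + g n. Proof. by []. Qed.
Lemma pserBE (f g : pser) n : (f - g) n = f n - g n. Proof. by []. Qed.
Lemma pser1E n : (1 : pser) n = (n == 0%N)%:R. Proof. by []. Qed.
Lemma pser_sumE I (r : seq I) (P : pred I) (F : I -> pser) n :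
  (\sum_(i <- r | P i) F i) n = \sum_(i <- r | P i) F i n.
Proof. by apply: (big_morph (fun f : pser => f n)). Qed.
Lemma pserMnE (f : pser) m n : (f *+ m) n = f n *+ m.
Proof. by elim: m => // m ih; rewrite !mulrS pserDE ih. Qed.

Definition pserC (c : K) : pser := fun i => if i == 0%N then c else 0.

Lemma pserCME c (f : pser) n : (pserC c * f) n = c * f n.
Proof.
rewrite pserME big_ord_recl subn0 big1 ?addr0 // => i _.
by rewrite /pserC mul0r.
Qed.

Fact pserC_is_zmod_morphism : zmod_morphism pserC.
Proof.
by move=> a b; apply/funext => -[|i] //; rewrite pserBE /pserC /= subr0.
Qed.
Fact pserC_is_monoid_morphism : monoid_morphism pserC.
Proof.
split; first by apply/funext => -[|i].
move=> a b; apply/funext => i; rewrite pserCME /pserC.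
by case: eqP => //; rewrite mulr0.
Qed.
HB.instance Definition _ :=
  GRing.isZmodMorphism.Build K pser pserC pserC_is_zmod_morphism.
HB.instance Definition _ :=
  GRing.isMonoidMorphism.Build K pser pserC pserC_is_monoid_morphism.

Definition pserX : pser := fun i => (i == 1%N)%:R.

Lemma pserXME (f : pser) n : (pserX * f) n = if n is n'.+1 then f n' else 0.
Proof.
rewrite pserME; case: n => [|n]; first by rewrite big_ord1 mul0r.
rewrite 2!big_ord_recl /= mul0r add0r /pserX /= mul1r subSS subn0.
by rewrite big1 ?addr0 // => i _; rewrite mul0r.
Qed.

Lemma pserXnME (f : pser) m n :
  (pserX ^+ m * f) n = if (m <= n)%N then f (n - m)%N else 0.
Proof.
elim: m n => [|m ih] n; first by rewrite expr0 mul1r subn0.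
by rewrite exprS -mulrA pserXME; case: n => // n; rewrite ih ltnS subSS.
Qed.

Lemma pserXnE m n : (pserX ^+ m) n = (n == m)%:R.
Proof.
by rewrite -[pserX ^+ m]mulr1 pserXnME pser1E subn_eq0; case: ltngtP.
Qed.

Definition pser_geom : pser := fun=> 1.

Lemma pser_geom_inv : (1 - pserX) * pser_geom = 1.
Proof.
apply/funext => i; rewrite mulrBl mul1r pserBE pserXME.
by case: i => [|i]; rewrite ?subr0 // subrr.
Qed.

Lemma pser_geomME (f : pser) n : (pser_geom * f) n = \sum_(i < n.+1) f i.
Proof. by rewrite mulrC pserME; apply: eq_bigr => i _; rewrite mulr1. Qed.

End PowerSeries.

(** * Derivations and Euler operators *)

Definition derivation (B : nzRingType) (D : B -> B) : Prop :=
  (forall x y, D (x + y) = D x + D y) /\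
  (forall x y, D (x * y) = D x * y + x * D y).

Section Derivations.
Variables (B : nzRingType) (D : B -> B).
Hypothesis derD : derivation D.

Lemma derivationD x y : D (x + y) = D x + D y. Proof. exact: derD.1. Qed.
Lemma derivationM x y : D (x * y) = D x * y + x * D y. Proof. exact: derD.2. Qed.
Lemma derivation0 : D 0 = 0.
Proof. by apply: (addIr (D 0)); rewrite -derivationD !add0r. Qed.
Lemma derivation1 : D 1 = 0.
Proof.
by apply: (addIr (D 1)); rewrite add0r -{3}[1]mulr1 derivationM mulr1 mul1r.
Qed.
Lemma derivationN x : D (- x) = - D x.
Proof. by apply/eqP; rewrite -addr_eq0 -derivationD addNr derivation0. Qed.
Lemma derivationB x y : D (x - y) = D x - D y.
Proof. by rewrite derivationD derivationN. Qed.
Lemma derivation_sum I (r : seq I) (P : pred I) (F : I -> B) :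
  D (\sum_(i <- r | P i) F i) = \sum_(i <- r | P i) D (F i).
Proof. exact: (big_morph D derivationD derivation0). Qed.
Lemma derivation_natr n : D n%:R = 0.
Proof.
by elim: n => [|n ih]; rewrite ?derivation0 // -natr1 derivationD ih derivation1 addr0.
Qed.

End Derivations.

Section MoreDerivations.
Variables (B : comNzRingType) (D : B -> B).
Hypothesis derD : derivation D.

Lemma derivationX x n : D (x ^+ n) = n%:R * x ^+ n.-1 * D x.
Proof.
elim: n => [|n ih]; first by rewrite (derivation1 derD) !mul0r.
rewrite exprS (derivationM derD) ih; case: n {ih} => [|n] /=;
    first by rewrite !expr0; ring.
by rewrite !exprS -[n.+2%:R]natr1; ring.
Qed.

Lemma derivation_Xeigen x n : D x = x -> D (x ^+ n) = n%:R * x ^+ n.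
Proof.
move=> Dx; rewrite derivationX Dx; case: n => [|n] /=; first by rewrite !mul0r.
by rewrite exprS; ring.
Qed.

Lemma derivation_prod (I : finType) (P : pred I) (F : I -> B) :
  D (\prod_(i | P i) F i) =
  \sum_(i | P i) D (F i) * \prod_(j | P j && (j != i)) F j.
Proof.
(* The induction needs a duplicate-free list, since [j != i] removes every occurrence of [i]. *)
have gen (r : seq I) : uniq r -> D (\prod_(i <- r | P i) F i) =
    \sum_(i <- r | P i) D (F i) * \prod_(j <- r | P j && (j != i)) F j.
  elim: r => [|i r ih]; first by rewrite !big_nil (derivation1 derD).
  move=> /= /andP[ir ur]; rewrite [X in D X]big_cons [RHS]big_cons.
  have Er: \prod_(j <- r | P j && (j != i)) F j = \prod_(j <- r | P j) F j.
    rewrite [RHS]big_seq_cond [LHS]big_seq_cond; apply: eq_bigl => j.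
    by case: (P j); rewrite ?andbT ?andbF //; case: eqP => [->|];
        rewrite ?andbT // (negPf ir).
  case: ifP => Pi; last first.
    by rewrite ih //; apply: eq_bigr => j Pj; rewrite big_cons Pi.
  rewrite big_cons eqxx andbF /= Er.
  rewrite (derivationM derD) ih //; congr (_ + _).
  rewrite mulr_sumr big_seq_cond [RHS]big_seq_cond.
  apply: eq_bigr => j /andP[jr Pj]; rewrite big_cons Pi /=.
  by case: eqP => [ji|_]; [rewrite ji jr in ir | rewrite mulrCA].
exact/gen/index_enum_uniq.
Qed.

End MoreDerivations.

Section PserDerivations.
Variable K : comNzRingType.

(** The Euler operator [x d/dx], a derivation because degrees add up; unlike [d/dx] it acts
    diagonally on coefficients. *)
Definition pser_deriv (f : pser K) : pser K := fun i => i%:R * f i.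
Definition pser_map (L : comNzRingType) (u : K -> L) (f : pser K) : pser L :=
  fun i => u (f i).

Lemma pser_deriv_derivation : derivation pser_deriv.
Proof.
split=> f g; apply/funext => n; first by rewrite /pser_deriv pserDE mulrDr.
rewrite pserDE !pserME /pser_deriv pserME mulr_sumr -big_split.
apply: eq_bigr => i _ /=; have -> : n%:R = i%:R + (n - i)%:R :> K by rewrite -natrD
    subnKC // leq_ord.
by ring.
Qed.

Lemma pser_map_derivation (D : K -> K) :
  derivation D -> derivation (pser_map D : pser K -> pser K).
Proof.
move=> derD; split=> f g; apply/funext => n.
  by rewrite /pser_map pserDE (derivationD derD).
rewrite pserDE !pserME /pser_map pserME (derivation_sum derD) -big_split.
by apply: eq_bigr => i _ /=; rewrite (derivationM derD).
Qed.

End PserDerivations.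

(** * Cutting and joining cycles *)

Section Cycles.
Variable T : finType.
Implicit Types (s : {perm T}) (x y : T).

Lemma porbit_iter s x n : iter n s x \in porbit s x.
Proof. by rewrite -permX mem_porbit. Qed.

Lemma porbit_eq_iter s x n : porbit s (iter n s x) = porbit s x.
Proof. by rewrite -permX porbit_perm. Qed.

Lemma porbit_eq_of_mem s x y z :
  y \in porbit s x -> y \in porbit s z -> porbit s x = porbit s z.
Proof. by rewrite -!eq_porbit_mem => /eqP <- /eqP. Qed.

Lemma mem_porbits s x : porbit s x \in porbits s.
Proof. exact: imset_f. Qed.

Lemma porbits_eq s C x : C \in porbits s -> x \in C -> C = porbit s x.
Proof.
by case/imsetP => y _ -> xy; apply: (porbit_eq_of_mem xy); exact: porbit_id.
Qed.

Lemma iter_porbit_neq s x k : (0 < k < #|porbit s x|)%N -> iter k s x != x.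
Proof.
move=> /andP[k0 kr]; have m0 := ltn_trans k0 kr.
rewrite -[X in _ != X]/(iter 0 s x) -(nth_traject s kr) -(nth_traject s m0).
by rewrite nth_uniq ?size_traject ?uniq_traject_porbit // -lt0n.
Qed.

Lemma porbit_traject_eq s x m : (0 < m)%N -> iter m s x = x ->
  uniq (traject s x m) -> porbit s x =i traject s x m.
Proof.
move=> m0 mx um; have sub : {subset porbit s x <= traject s x m}.
  move=> y /porbitP[n ->]; rewrite permX (divn_eq n m) addnC iterD.
  have -> : iter (n %/ m * m) s x = x.
    by elim: (n %/ m)%N => // k ih; rewrite mulSn addnC iterD mx.
  by apply/trajectP; exists (n %% m)%N => //; rewrite ltn_mod.
move=> y; apply/idP/idP => [/sub//|/trajectP[i _ ->]]; exact: porbit_iter.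
Qed.

Lemma card_porbit_traject s x m : (0 < m)%N -> iter m s x = x ->
  uniq (traject s x m) -> #|porbit s x| = m.
Proof.
move=> m0 mx um; rewrite (eq_card (porbit_traject_eq m0 mx um)).
by rewrite (card_uniqP um) size_traject.
Qed.

Section Split.
Variables (s : {perm T}) (x : T) (r : nat).
Let m := #|porbit s x|.
Let y := iter r s x.
(** As products act from left to right, [t] differs from [s] only at the predecessors of [x] and
    [y]: the arc from [x] up to just before [y] closes up at [x], and the rest of the cycle closes
    up at [y]. *)
Let t := (s * tperm x y)%g.
Hypotheses (r0 : (0 < r)%N) (rm : (r < m)%N).

Let um : uniq (traject s x m). Proof. exact: uniq_traject_porbit. Qed.

Let iter_inj i j : (i < m)%N -> (j < m)%N ->
  iter i s x = iter j s x -> i = j.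
Proof.
move=> im jm e; apply/eqP; rewrite -(nth_uniq x _ _ um) ?size_traject //.
by rewrite !nth_traject // e.
Qed.

Let m0 : (0 < m)%N. Proof. exact: leq_trans rm. Qed.

Let tE z : t z = tperm x y (s z). Proof. by rewrite permM. Qed.

Let t_generic k : (k.+1 < m)%N -> k.+1 != r ->
  t (iter k s x) = iter k.+1 s x.
Proof.
move=> km kr; rewrite tE -iterS tpermD //.
  apply/eqP => /(@iter_inj 0%N k.+1 m0 km); done.
by apply/eqP => /(@iter_inj r k.+1 rm km) e; rewrite e eqxx in kr.
Qed.

Let t_iter_x k : (k < r)%N -> iter k t x = iter k s x.
Proof.
elim: k => // k ih kr; rewrite iterS ih; last exact: ltnW.
by rewrite t_generic ?neq_ltn ?kr // (ltn_trans kr).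
Qed.

Let t_iter_y k : (k < m - r)%N -> iter k t y = iter (k + r) s x.
Proof.
elim: k => // k ih kr; rewrite iterS ih; last exact: ltnW.
by rewrite t_generic //; lia.
Qed.

Let t_back_x : iter r t x = x.
Proof.
have -> : r = r.-1.+1 by rewrite prednK.
rewrite iterS t_iter_x ?prednK // tE -iterS prednK //.
exact: tpermR.
Qed.

Let t_back_y : iter (m - r) t y = y.
Proof.
have mr : (0 < m - r)%N by rewrite subn_gt0.
have -> : (m - r)%N = (m - r).-1.+1 by rewrite prednK.
rewrite iterS t_iter_y ?prednK // tE -iterS -addSn prednK // subnK; last exact: ltnW.
by rewrite iter_porbit tpermL.
Qed.

Let traj_x : traject t x r = take r (traject s x m).
Proof.
apply: (@eq_from_nth _ x); rewrite ?size_traject ?size_takel ?size_traject ?(ltnW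
    rm) //.
by move=> i ir; rewrite nth_take // !nth_traject // ?t_iter_x // (ltn_trans ir).
Qed.

Let traj_y : traject t y (m - r) = drop r (traject s x m).
Proof.
apply: (@eq_from_nth _ x); rewrite ?size_traject ?size_drop ?size_traject //.
move=> i ir; have irm : (r + i < m)%N by lia.
rewrite nth_drop nth_traject // (set_nth_default y) ?size_traject //.
by rewrite nth_traject // t_iter_y // addnC.
Qed.

Lemma split_card_x : #|porbit t x| = r.
Proof.
apply: card_porbit_traject => //.
by rewrite traj_x take_uniq.
Qed.

Lemma split_card_y : #|porbit t y| = (m - r)%N.
Proof.
apply: card_porbit_traject; rewrite ?subn_gt0 //.
by rewrite traj_y drop_uniq.
Qed.

Let px : porbit t x =i take r (traject s x m).
Proof. by rewrite -traj_x; apply: porbit_traject_eq; rewrite ?traj_x ?take_uniq. Qed.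

Let py : porbit t y =i drop r (traject s x m).
Proof.
by rewrite -traj_y; apply: porbit_traject_eq; rewrite ?subn_gt0 ?traj_y ?drop_uniq.
Qed.

Lemma split_union z :
  (z \in porbit s x) = (z \in porbit t x) || (z \in porbit t y).
Proof. by rewrite px py -mem_cat cat_take_drop porbit_traject. Qed.

Lemma split_neq : porbit t x != porbit t y.
Proof.
apply/eqP => e; have := porbit_id t x; rewrite {1}e.
have := porbit_id t x; rewrite px py => h1 h2.
have := um; rewrite -(cat_take_drop r (traject s x m)) cat_uniq.
by case/and3P => _ /hasPn /(_ _ h2); rewrite h1.
Qed.

Lemma split_other z : z \notin porbit s x -> porbit t z = porbit s z.
Proof.
move=> zx; have ext n : iter n t z = iter n s z.
  elim: n => // n ih; rewrite !iterS ih tE tpermD // -iterS; apply: contraNneq zx => e.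
    by rewrite porbit_sym -(porbit_eq_iter s z n.+1) -e porbit_id.
  rewrite -eq_porbit_mem eq_sym -(porbit_eq_iter s z n.+1) -e.
  by rewrite /y porbit_eq_iter.
apply/setP => w; apply/porbitP/porbitP => -[n ->]; exists n;
  by rewrite !permX ext.
Qed.

Lemma split_porbits :
  porbits t = porbit t x |: (porbit t y |: (porbits s :\ porbit s x)).
Proof.
apply/setP => C; rewrite !inE; apply/idP/idP.
  case/imsetP => z _ ->; have [zx|zx] := boolP (z \in porbit s x).
    move: zx; rewrite split_union -!eq_porbit_mem => /orP[->//|->].
    by rewrite orbT.
  by rewrite split_other // mem_porbits eq_porbit_mem zx !orbT.
case/or3P => [/eqP->|/eqP->|/andP[Cx /imsetP[z _ Ez]]]; rewrite ?mem_porbits //.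
by rewrite Ez -split_other ?mem_porbits // -eq_porbit_mem -Ez.
Qed.

Variables (B : comNzRingType) (p : nat -> B).

Lemma split_prod :
  \prod_(C in porbits t) p #|C| =
  p r * p (m - r)%N * \prod_(C in porbits s | C != porbit s x) p #|C|.
Proof.
have sxy z : z \in porbit s x -> (porbit t z \in porbits s :\ porbit s x) = false.
  move=> zx; apply/negbTE/negP; rewrite !inE => /andP[nx tz]; case/negP: nx.
  by rewrite (porbits_eq tz (porbit_id t z)) eq_porbit_mem.
rewrite split_porbits big_setU1 /=; last first.
  by rewrite inE negb_or inE split_neq sxy ?porbit_id.
rewrite big_setU1 /=; last by rewrite sxy // porbit_iter.
rewrite split_card_x split_card_y mulrA; congr (_ * _).
by apply: eq_bigl => C; rewrite !inE andbC.
Qed.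

End Split.

(** A transposition is an involution, so joining is cutting read backwards: [s] is the joined
    permutation [u], cut at [x] and at [y = u^r x] with [r] the length of the cycle of [x] in
    [s]. *)
Lemma join_prod (B : comNzRingType) (p : nat -> B) s x y :
  y \notin porbit s x ->
  \prod_(C in porbits (s * tperm x y)%g) p #|C| =
  p (#|porbit s x| + #|porbit s y|)%N *
  \prod_(C in porbits s | (C != porbit s x) && (C != porbit s y)) p #|C|.
Proof.
move=> xy; set u := (s * tperm x y)%g.
have su : s = (u * tperm x y)%g by rewrite -mulgA tperm2 mulg1.
have uE z : u z = tperm x y (s z) by rewrite permM.
set r := #|porbit s x|.
have yx : x \notin porbit s y by rewrite porbit_sym.
have ux k : (k < r)%N -> iter k u x = iter k s x.
  elim: k => // k ih kr; rewrite !iterS ih; last exact: ltnW.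
  rewrite uE tpermD // -iterS.
    by rewrite eq_sym iter_porbit_neq // kr.
  by apply: contraNneq xy => ->; exact: porbit_iter.
have r0 : (0 < r)%N by rewrite lt0n card_porbit_neq0.
have ury : iter r u x = y.
  have -> : r = r.-1.+1 by rewrite prednK.
  by rewrite iterS ux ?prednK // uE -iterS prednK // iter_porbit tpermL.
have rm : (r < #|porbit u x|)%N.
  rewrite /r; apply: proper_card; apply/properP; split.
    apply/fintype.subsetP => z; rewrite porbit_traject => /trajectP[k kr ->].
    by rewrite -ux // porbit_iter.
  by exists y => //; rewrite -ury porbit_iter.
have us : (u * tperm x (iter r u x))%g = s by rewrite ury -su.
have := @split_union u x r r0 rm; have := @split_card_y u x r r0 rm.
have := @split_porbits u x r r0 rm; have := @split_neq u x r r0 rm.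
have := @split_other u x r.
rewrite us ury => So Sn Sp Sc Su.
have Cu : #|porbit u x| = (#|porbit s x| + #|porbit s y|)%N.
  by rewrite Sc subnKC // ltnW.
rewrite -Cu (bigD1 (porbit u x)) ?mem_porbits //=; congr (_ * _).
apply: eq_bigl => C; rewrite Sp !inE.
have nx z : z \in porbit u x -> C == porbit s z -> (C \in porbits u) && (C !=
    porbit u x) = false.
  move=> zu /eqP Cz; apply/negbTE/negP => /andP[Cp];
      rewrite (porbits_eq Cp (x := z)) ?Cz ?porbit_id //.
  by rewrite eq_porbit_mem zu.
case: (eqVneq C (porbit s x)) => [e|_] /=.
  by apply: (nx x); rewrite ?porbit_id ?e.
case: (eqVneq C (porbit s y)) => [e|_] /=.
  by apply: (nx y); rewrite ?e // -ury porbit_iter.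
by rewrite andbT andbC.
Qed.

End Cycles.

Section CutJoin.
Variables (T : finType) (B : comNzRingType).
Implicit Types (s : {perm T}) (p : nat -> B).

Definition cyc_prod p s : B := \prod_(C in porbits s) p #|C|.

(** First and second polarisations of [cyc_prod]: the weight is changed at one cycle, respectively
    at an ordered pair of distinct cycles. Derivations and transpositions both lead to such sums. *)
Definition cyc_sum1 p (q : nat -> B) s : B :=
  \sum_(C in porbits s) q #|C| * \prod_(D in porbits s | D != C) p #|D|.

Definition cyc_sum2 p (q : nat -> nat -> B) s : B :=
  \sum_(C in porbits s) \sum_(D in porbits s | D != C) q #|C| #|D| *
    \prod_(E in porbits s | (E != C) && (E != D)) p #|E|.

Lemma sum_porbit s (g : {set T} -> B) :
  \sum_x g (porbit s x) = \sum_(C in porbits s) #|C|%:R * g C.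
Proof.
rewrite (partition_big (porbit s) (mem (porbits s))) => [|x _]; last exact: mem_porbits.
apply: eq_bigr => C CP; rewrite (eq_bigr (fun=> g C)) => [|x /eqP ->//].
rewrite sumr_const mulr_natl; congr (_ *+ _); apply: eq_card => x.
rewrite -[LHS]/(porbit s x == C); apply/eqP/idP => [<-|xC]; first exact: porbit_id.
by rewrite -(porbits_eq CP xC).
Qed.

Lemma sum_mem_porbit s x (F : T -> B) :
  \sum_(y in porbit s x) F y = \sum_(0 <= i < #|porbit s x|) F (iter i s x).
Proof.
rewrite (eq_bigl (mem (traject s x #|porbit s x|))); last exact: porbit_traject.
rewrite -big_uniq ?uniq_traject_porbit //= (big_nth x) size_traject.
by apply: eq_big_nat => i /andP[_ im]; rewrite nth_traject.
Qed.

(** A pair inside a cycle of length m amounts to one of m points [x] and a distance [r]; a pair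
    across two cycles can be chosen in m m' ways. The pairs are ordered, so every transposition
    occurs twice. *)
Lemma cut_join p s :
  \sum_x \sum_(y | y != x) cyc_prod p (s * tperm x y)%g =
  cyc_sum1 p (fun m => m%:R * \sum_(1 <= r < m) p r * p (m - r)%N) s +
  cyc_sum2 p (fun m m' => m%:R * m'%:R * p (m + m')%N) s.
Proof.
pose cut (C : {set T}) := (\sum_(1 <= r < #|C|) p r * p (#|C| - r)%N) *
    \prod_(D in porbits s | D != C) p #|D|.
pose join (C D : {set T}) := p (#|C| + #|D|)%N *
    \prod_(E in porbits s | (E != C) && (E != D)) p #|E|.
transitivity (\sum_x (cut (porbit s x) +
   \sum_y if porbit s y != porbit s x then join (porbit s x) (porbit s y) else 0)).
  apply: eq_bigr => x _; rewrite (bigID (mem (porbit s x))) /=; congr (_ + _).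
    rewrite (eq_bigl (fun y => (y \in porbit s x) && (y != x))) => [|y];
        last by rewrite andbC.
    rewrite big_mkcondr sum_mem_porbit.
    have m0 : (0 < #|porbit s x|)%N by rewrite lt0n card_porbit_neq0.
    rewrite big_ltn //= eqxx add0r /cut mulr_suml; apply: eq_big_nat => r /andP[r0 rm].
    rewrite iter_porbit_neq ?r0 //; exact: split_prod.
  rewrite [RHS](eq_bigr (fun y => if y \notin porbit s x then join (porbit s x)
      (porbit s y) else 0)); last first.
    by move=> y _; rewrite eq_porbit_mem.
  rewrite -big_mkcond /=; apply: eq_big => [y|y /andP[_ yx]].
    by rewrite andb_idl //; apply: contraNneq => ->; exact: porbit_id.
  exact: join_prod.
rewrite big_split /=; congr (_ + _).
  by rewrite (sum_porbit s cut); apply: eq_bigr => C _; rewrite /cut mulrA.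
rewrite (eq_bigr (fun x => \sum_(C in porbits s | C != porbit s x)
   #|C|%:R * join (porbit s x) C)) => [|x _]; last first.
  rewrite (sum_porbit s (fun C => if C != porbit s x then join (porbit s x) C else 0)).
  by rewrite [RHS]big_mkcondr /=; apply: eq_bigr => C _; case: ifP; rewrite ?mulr0.
rewrite (sum_porbit s (fun C => \sum_(D in porbits s | D != C) #|D|%:R * join C D)).
by apply: eq_bigr => C _; rewrite mulr_sumr; apply: eq_bigr => D _; rewrite !mulrA.
Qed.

Lemma cyc_sum1D p q q' s :
  cyc_sum1 p (fun m => q m + q' m) s = cyc_sum1 p q s + cyc_sum1 p q' s.
Proof. by rewrite -big_split; apply: eq_bigr => C _; rewrite mulrDl. Qed.

Lemma cyc_sum1Z p c q s : cyc_sum1 p (fun m => c * q m) s = c * cyc_sum1 p q s.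
Proof. by rewrite mulr_sumr; apply: eq_bigr => C _; rewrite mulrA. Qed.

Lemma cyc_sum1N p q s : cyc_sum1 p (fun m => - q m) s = - cyc_sum1 p q s.
Proof. by rewrite -mulN1r -cyc_sum1Z; apply: eq_bigr => C _; rewrite mulN1r. Qed.

Lemma cyc_sum2D p q q' s :
  cyc_sum2 p (fun m m' => q m m' + q' m m') s = cyc_sum2 p q s + cyc_sum2 p q' s.
Proof.
rewrite -big_split; apply: eq_bigr => C _; rewrite -big_split.
by apply: eq_bigr => D _; rewrite mulrDl.
Qed.

Lemma cyc_sum2Z p c q s :
  cyc_sum2 p (fun m m' => c * q m m') s = c * cyc_sum2 p q s.
Proof.
rewrite mulr_sumr; apply: eq_bigr => C _; rewrite mulr_sumr.
by apply: eq_bigr => D _; rewrite mulrA.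
Qed.

Lemma card_porbits_gt0 s C : C \in porbits s -> (0 < #|C|)%N.
Proof. by case/imsetP => x _ ->; rewrite lt0n card_porbit_neq0. Qed.

Lemma eq_cyc_sum1 p q q' s : (forall m, (0 < m)%N -> q m = q' m) ->
  cyc_sum1 p q s = cyc_sum1 p q' s.
Proof. by move=> qq; apply: eq_bigr => C /card_porbits_gt0 /qq ->. Qed.

Lemma cyc_sum1_id p s :
  cyc_sum1 p (fun m => m%:R * p m) s = #|T|%:R * cyc_prod p s.
Proof.
transitivity (\sum_(C in porbits s) #|C|%:R * cyc_prod p s).
  by apply: eq_bigr => C CP; rewrite -mulrA -(bigD1 C (P := mem (porbits s))).
by rewrite -(sum_porbit s (fun=> cyc_prod p s)) sumr_const mulr_natl.
Qed.

(** With [p] restored at the second cycle only its length remains, and the lengths of the cycles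
    other than the first add up to [#|T| - m]. *)
Lemma cyc_sum2_id p q s :
  cyc_sum2 p (fun m m' => q m * (m'%:R * p m')) s =
  cyc_sum1 p (fun m => (#|T|%:R - m%:R) * q m) s.
Proof.
apply: eq_bigr => C CP; rewrite mulrAC [X in _ = X * _]mulrBl.
have -> : #|T|%:R * \prod_(D in porbits s | D != C) p #|D| =
    \sum_(D in porbits s) #|D|%:R * \prod_(D in porbits s | D != C) p #|D|.
  by rewrite -(sum_porbit s (fun=> _)) sumr_const mulr_natl.
rewrite [X in _ = (X - _) * _](bigD1 C) //= [X in (X - _) * _]addrC addrK mulr_suml.
apply: eq_bigr => D /andP[DP DC]; rewrite [X in _ = _ * X * _](bigD1 D) /= ?DP //.
under [X in _ = _ * (_ * X) * _]eq_bigl do rewrite -andbA.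
by ring.
Qed.

Lemma derivation_cyc_prod (d : B -> B) p s : derivation d ->
  d (cyc_prod p s) = cyc_sum1 p (d \o p) s.
Proof. by move=> derd; rewrite (derivation_prod derd). Qed.

Lemma derivation_cyc_sum1 (d : B -> B) p q s : derivation d ->
  d (cyc_sum1 p q s) =
  cyc_sum1 p (d \o q) s + cyc_sum2 p (fun m m' => q m * d (p m')) s.
Proof.
move=> derd; rewrite (derivation_sum derd) -big_split; apply: eq_bigr => C CP.
rewrite (derivationM derd) /=; congr (_ + _).
rewrite (derivation_prod derd) mulr_sumr; apply: eq_bigr => D /andP[DP DC].
rewrite mulrA; congr (_ * _); apply: eq_bigl => E.
by rewrite andbA.
Qed.

End CutJoin.

(** * The generator in power sum variables *)

(* [D1], [D2], [Dw] are the Euler operators of the three even variables and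
   [g1], [g2] the inverses of [1 - x1], [1 - x2].  The odd variable is set to 1;
   its Euler operator is recovered from homogeneity, see [Av] and [Bvv]. *)
Section SuperLaplacian.
Variables (T : finType) (B : comNzRingType) (x1 x2 w g1 g2 : B).
Variables D1 D2 Dw : B -> B.
Hypotheses (der1 : derivation D1) (der2 : derivation D2) (derw : derivation Dw).
Hypotheses (D1x1 : D1 x1 = x1) (D1x2 : D1 x2 = 0) (D1w : D1 w = 0).
Hypotheses (D2x1 : D2 x1 = 0) (D2x2 : D2 x2 = x2) (D2w : D2 w = 0).
Hypotheses (Dwx1 : Dw x1 = 0) (Dwx2 : Dw x2 = 0) (Dww : Dw w = w).
Hypotheses (D12 : forall y, D2 (D1 y) = D1 (D2 y)).
Hypotheses (D1wC : forall y, Dw (D1 y) = D1 (Dw y)).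
Hypotheses (D2wC : forall y, Dw (D2 y) = D2 (Dw y)).
Hypotheses (g1_inv : (1 - x1) * g1 = 1) (g2_inv : (1 - x2) * g2 = 1).

Let p (m : nat) : B := x1 ^+ m + x2 ^+ m + w ^+ m - 1.

Variable s : {perm T}.
Let N : B := #|T|%:R.
Let W : B := cyc_prod p s.

Let geo (a b : B) (m : nat) : B := \sum_(1 <= r < m) a ^+ r * b ^+ (m - r).

(** The sum telescopes; the end terms [r = 0] and [r = m] are absent from [geo], whence the extra
    factors [b] and [a]. *)
Let geoE a b m : (0 < m)%N -> (a - b) * geo a b m = a ^+ m * b - a * b ^+ m.
Proof.
move=> m0; rewrite mulr_sumr.
rewrite (eq_big_nat _ _ (F2 := fun r =>
  (fun r => a ^+ r * b ^+ (m - r).+1) r.+1 - (fun r => a ^+ r * b ^+ (m - r).+1) r)).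
  by rewrite telescope_sumr // subnn expr1 -subSn // subSS subn0 expr1.
move=> r /andP[r1 rm] /=; rewrite subnSK // !exprS; ring.
Qed.

Let geoC a b m : geo a b m = \sum_(1 <= r < m) a ^+ (m - r) * b ^+ r.
Proof.
rewrite /geo big_nat_rev /=; apply: eq_big_nat => r /andP[r1 rm].
by rewrite add1n subSS subKn // ltnW.
Qed.

(** Squares of a variable give the same m-th power for each [r], mixed products give the [geo] sums.
    The odd variable enters the squares with sign + and its mixed products with sign -. *)
Let cutE m : (0 < m)%N ->
  \sum_(1 <= r < m) p r * p (m - r)%N =
  (m%:R - 1) * (x1 ^+ m + x2 ^+ m + w ^+ m + 1) +
  2 * (geo x1 x2 m + geo x1 w m + geo x2 w m
       - geo x1 1 m - geo x2 1 m - geo w 1 m).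
Proof.
move=> m0; have -> : (m%:R - 1) * (x1 ^+ m + x2 ^+ m + w ^+ m + 1) =
   \sum_(1 <= r < m) (x1 ^+ m + x2 ^+ m + w ^+ m + 1).
  by rewrite sumr_const_nat -[RHS]mulr_natl natrB.
have geo2 a b : 2 * geo a b m =
    \sum_(1 <= r < m) (a ^+ r * b ^+ (m - r) + a ^+ (m - r) * b ^+ r).
  by rewrite big_split /= -geoC -/(geo a b m); ring.
rewrite [2 * _]mulrBr 2![2 * (_ - _)]mulrBr 2![2 * (_ + _)]mulrDr !geo2.
do ![rewrite -sumrB | rewrite -big_split /=].
apply: eq_big_nat => r /andP[r1 rm].
have e (a : B) : a ^+ m = a ^+ r * a ^+ (m - r) by rewrite -exprD subnKC // ltnW.
rewrite /p !e !expr1n; ring.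
Qed.

Let A1 := D1 W.
Let A2 := D2 W.
Let Aw := Dw W.
Let Av := N * W - A1 - A2 - Aw.

Let derp D (e1 e2 e3 : B) m : derivation D ->
  D x1 = e1 * x1 -> D x2 = e2 * x2 -> D w = e3 * w ->
  D (p m) = m%:R * (e1 * x1 ^+ m + e2 * x2 ^+ m + e3 * w ^+ m).
Proof.
move=> der h1 h2 h3; rewrite /p (derivationB der) (derivation1 der).
rewrite !(derivationD der) !(derivationX der) h1 h2 h3.
case: m => [|m] /=; first by rewrite !mul0r !addr0 subr0.
by rewrite !exprS; ring.
Qed.

Let d1p m : D1 (p m) = m%:R * x1 ^+ m.
Proof. by rewrite (@derp D1 1 0 0) // ?mul1r ?mul0r ?addr0. Qed.
Let d2p m : D2 (p m) = m%:R * x2 ^+ m.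
Proof. by rewrite (@derp D2 0 1 0) // ?mul1r ?mul0r ?addr0 ?add0r. Qed.
Let dwp m : Dw (p m) = m%:R * w ^+ m.
Proof. by rewrite (@derp Dw 0 0 1) // ?mul1r ?mul0r ?addr0 ?add0r. Qed.

Let c1 q := cyc_sum1 p q s.
Let c2 q := cyc_sum2 p q s.

Let eqc1 q q' : (forall m, (0 < m)%N -> q m = q' m) -> c1 q = c1 q'.
Proof. exact: eq_cyc_sum1. Qed.
Let eqc2 q q' : (forall m m', q m m' = q' m m') -> c2 q = c2 q'.
Proof.
by move=> e; apply: eq_bigr => C _; apply: eq_bigr => D _; rewrite e.
Qed.

Let A1E : A1 = c1 (fun m => m%:R * x1 ^+ m).
Proof. by rewrite /A1 (derivation_cyc_prod _ _ der1); apply: eqc1 => m _;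
    exact: d1p. Qed.
Let A2E : A2 = c1 (fun m => m%:R * x2 ^+ m).
Proof. by rewrite /A2 (derivation_cyc_prod _ _ der2); apply: eqc1 => m _;
    exact: d2p. Qed.
Let AwE : Aw = c1 (fun m => m%:R * w ^+ m).
Proof. by rewrite /Aw (derivation_cyc_prod _ _ derw); apply: eqc1 => m _;
    exact: dwp. Qed.

(** The Euler operator of an odd variable v sends [- v^m] to [- m v^m], which is [- m] at v = 1. *)
Let AvE : Av = c1 (fun m => - m%:R).
Proof.
rewrite /Av /N -(cyc_sum1_id p s) -/(c1 _) A1E A2E AwE.
have -> : c1 (fun m => m%:R * p m) = c1 (fun m => m%:R * x1 ^+ m) +
   c1 (fun m => m%:R * x2 ^+ m) + c1 (fun m => m%:R * w ^+ m) + c1 (fun m => - m%:R).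
  by rewrite -!cyc_sum1D; apply: eqc1 => m _; rewrite /p; ring.
ring.
Qed.

Let diag (D : B -> B) (a : B) : derivation D -> D a = a ->
  (forall m, D (p m) = m%:R * a ^+ m) ->
  D (c1 (fun m => m%:R * a ^+ m)) =
  c1 (fun m => m%:R ^+ 2 * a ^+ m) + c2 (fun m m' => m%:R * m'%:R * a ^+ (m + m')).
Proof.
move=> der Da Dp; rewrite /c1 (derivation_cyc_sum1 _ _ _ der); congr (_ + _).
  apply: eqc1 => m _ /=; rewrite (derivationM der) (derivation_natr der).
  by rewrite (derivation_Xeigen der _ Da); ring.
by apply: eqc2 => m m'; rewrite Dp exprD; ring.
Qed.

(** By homogeneity again, the left side is the second Euler derivative in the odd variable. On two
    cycles the signs cancel, on a single one the sign stays. *)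
Let Bvv : N * Av - (D1 Av + D2 Av + Dw Av) =
  c2 (fun m m' => m%:R * m'%:R) - c1 (fun m => m%:R ^+ 2).
Proof.
have dv D a : derivation D -> (forall m, D (p m) = m%:R * a ^+ m) ->
    D Av = c2 (fun m m' => - m%:R * (m'%:R * a ^+ m')).
  move=> der Dp; rewrite AvE /c1 (derivation_cyc_sum1 _ _ _ der).
  rewrite [X in X + _]big1 ?add0r; last first.
    by move=> C _; rewrite /= (derivationN der) (derivation_natr der) oppr0 mul0r.
  by apply: eqc2 => m m'; rewrite Dp.
rewrite (dv _ _ der1 d1p) (dv _ _ der2 d2p) (dv _ _ derw dwp) -!cyc_sum2D.
have -> : cyc_sum2 p (fun m m' => - m%:R * (m'%:R * x1 ^+ m') +
    - m%:R * (m'%:R * x2 ^+ m') + - m%:R * (m'%:R * w ^+ m')) s =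
    c2 (fun m m' => - m%:R * (m'%:R * p m')) - c2 (fun m m' => m%:R * m'%:R).
  rewrite -[- c2 _]mulN1r -cyc_sum2Z -cyc_sum2D; apply: eqc2 => m m'.
  by rewrite /p; ring.
rewrite /c2 cyc_sum2_id AvE.
have -> : cyc_sum1 p (fun m => (#|T|%:R - m%:R) * - m%:R) s =
   N * c1 (fun m => - m%:R) + c1 (fun m => m%:R ^+ 2).
  by rewrite -cyc_sum1Z -cyc_sum1D; apply: eqc1 => m _; rewrite /N; ring.
ring.
Qed.

Let M := \sum_x \sum_(y | y != x) cyc_prod p (s * tperm x y)%g.
Let tau a b := c1 (fun m => m%:R * geo a b m).

(** Cuts and joins within one variable combine to [D1^2 + D2^2 + Dw^2 - Dv^2], with Dv the Euler
    operator of the odd variable. Substituting [Dv = N - D1 - D2 - Dw] cancels all squares. *)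
Let ME : M = - N * (N - 1) * W + 2 * (N - 1) * (A1 + A2 + Aw)
   - 2 * (D1 A2 + D1 Aw + D2 Aw)
   + 2 * (tau x1 x2 + tau x1 w + tau x2 w - tau x1 1 - tau x2 1 - tau w 1).
Proof.
have cutsum : c1 (fun m => m%:R * \sum_(1 <= r < m) p r * p (m - r)%N) =
   c1 (fun m => m%:R ^+ 2 * x1 ^+ m) + c1 (fun m => m%:R ^+ 2 * x2 ^+ m)
   + c1 (fun m => m%:R ^+ 2 * w ^+ m) + c1 (fun m => m%:R ^+ 2)
   - A1 - A2 - Aw + Av
   + 2 * (tau x1 x2 + tau x1 w + tau x2 w - tau x1 1 - tau x2 1 - tau w 1).
  rewrite A1E A2E AwE AvE /tau.
  do ![rewrite -cyc_sum1N | rewrite -cyc_sum1Z | rewrite -cyc_sum1D].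
  by apply: eqc1 => m m0; rewrite cutE //; ring.
have joinsum : c2 (fun m m' => m%:R * m'%:R * p (m + m')%N) =
   c2 (fun m m' => m%:R * m'%:R * x1 ^+ (m + m'))
   + c2 (fun m m' => m%:R * m'%:R * x2 ^+ (m + m'))
   + c2 (fun m m' => m%:R * m'%:R * w ^+ (m + m'))
   - c2 (fun m m' => m%:R * m'%:R).
  rewrite -mulN1r -cyc_sum2Z -!cyc_sum2D.
  by apply: eqc2 => m m'; rewrite /p; ring.
rewrite /M cut_join -/(c1 _) -/(c2 _) cutsum joinsum.
have := Bvv; have := diag der1 D1x1 d1p; have := diag der2 D2x2 d2p.
have := diag derw Dww dwp; rewrite -A1E -A2E -AwE.
have -> : Av = N * W - A1 - A2 - Aw by [].
rewrite !(derivationB der1, derivationB der2, derivationB derw).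
rewrite !(derivationM der1, derivationM der2, derivationM derw).
rewrite !(derivation_natr der1, derivation_natr der2, derivation_natr derw).
rewrite -/A1 -/A2 -/Aw /A1 /A2 /Aw !D1wC !D2wC !D12 -/A1 -/A2 -/Aw.
move=> ew e2 e1 ev.
have {}ew := canRL (addKr _) (esym ew); have {}e2 := canRL (addKr _) (esym e2).
have {}e1 := canRL (addKr _) (esym e1); have {}ev := canRL (subrK _) (esym ev).
rewrite ew e2 e1 ev.
ring.
Qed.

Let tauE a b : (a - b) * tau a b =
  b * c1 (fun m => m%:R * a ^+ m) - a * c1 (fun m => m%:R * b ^+ m).
Proof.
rewrite /tau /c1 -!cyc_sum1Z -cyc_sum1N -cyc_sum1D; apply: eqc1 => m m0.
by rewrite mulrCA geoE //; ring.
Qed.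

Let tauE1 a : (a - 1) * tau a 1 = c1 (fun m => m%:R * a ^+ m) + a * Av.
Proof.
rewrite tauE mul1r AvE -mulrN /c1 -cyc_sum1N; congr (_ + _ * _).
by apply: eqc1 => m _; rewrite expr1n mulr1.
Qed.

Let deriv_inv D (x g e : B) : derivation D -> (1 - x) * g = 1 -> D x = e ->
  D g = e * (g * g).
Proof.
move=> der xg De; have := congr1 D xg.
rewrite (derivationM der) (derivationB der) (derivation1 der) De => h.
have -> : D g = g * (- e * g + (1 - x) * D g) + e * (g * g) + (1 - (1 - x) * g) * D g.
  by ring.
by rewrite xg subrr mul0r addr0 -[in - e]sub0r h mulr0 add0r.
Qed.

(* Every term is written over the common denominator of [G], which turns the
   final identity into a polynomial one. *)
Let u1 := 1 - x1.
Let u2 := 1 - x2.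
Let G := (g1 * g1) * (g2 * g2).
Let a11 : g1 * g2 = u1 * u2 * G.
Proof.
have -> : u1 * u2 * G = ((1 - x1) * g1) * ((1 - x2) * g2) * (g1 * g2).
  by rewrite /G /u1 /u2; ring.
by rewrite g1_inv g2_inv !mul1r.
Qed.
Let a21 : g1 * g1 * g2 = u2 * G.
Proof.
have -> : u2 * G = ((1 - x2) * g2) * (g1 * g1 * g2) by rewrite /G /u2; ring.
by rewrite g2_inv mul1r.
Qed.
Let a12 : g1 * (g2 * g2) = u1 * G.
Proof.
have -> : u1 * G = ((1 - x1) * g1) * (g1 * (g2 * g2)) by rewrite /G /u1; ring.
by rewrite g1_inv mul1r.
Qed.

(** The numerator of [h]; the subscripts below stand for its Euler derivatives. *)
Let V := (x1 - x2) * (x1 - w) * (x2 - w).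
Let V1 := x1 * (x1 - w) * (x2 - w) + (x1 - x2) * x1 * (x2 - w).
Let V2 := - x2 * (x1 - w) * (x2 - w) + (x1 - x2) * (x1 - w) * x2.
Let Vw := - w * (x1 - x2) * ((x2 - w) + (x1 - w)).
Let V12 := - x2 * x1 * (x2 - w) + x1 * (x1 - w) * x2 + (x1 - x2) * x1 * x2.
Let V1w := - w * (x1 * ((x2 - w) + (x1 - w)) + (x1 - x2) * x1).
Let V2w := - w * (- x2 * ((x2 - w) + (x1 - w)) + (x1 - x2) * x2).

(** The factor 1/(w - 1) is missing on purpose, as [w - 1] has no inverse in the series used below.
    The last term of [super_laplacian] compensates for it. *)
Definition super_vandermonde : B := (x1 - x2) * (x1 - w) * (x2 - w) * (g1 * g2).
Let h := super_vandermonde.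

Let d1g1 : D1 g1 = x1 * (g1 * g1). Proof. exact: (deriv_inv der1 g1_inv). Qed.
Let d1g2 : D1 g2 = 0. Proof. by rewrite (deriv_inv der1 g2_inv D1x2) mul0r. Qed.
Let d2g1 : D2 g1 = 0. Proof. by rewrite (deriv_inv der2 g1_inv D2x1) mul0r. Qed.
Let d2g2 : D2 g2 = x2 * (g2 * g2). Proof. exact: (deriv_inv der2 g2_inv). Qed.
Let dwg1 : Dw g1 = 0. Proof. by rewrite (deriv_inv derw g1_inv Dwx1) mul0r. Qed.
Let dwg2 : Dw g2 = 0. Proof. by rewrite (deriv_inv derw g2_inv Dwx2) mul0r. Qed.

Let d1rules := (derivationM der1, derivationD der1, derivationB der1,
  derivationN der1, D1x1, D1x2, D1w, d1g1, d1g2).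
Let d2rules := (derivationM der2, derivationD der2, derivationB der2,
  derivationN der2, D2x1, D2x2, D2w, d2g1, d2g2).
Let dwrules := (derivationM derw, derivationD derw, derivationB derw,
  derivationN derw, Dwx1, Dwx2, Dww, dwg1, dwg2).

Let hE : h = V * u1 * u2 * G.
Proof. by rewrite /h /super_vandermonde a11 /V; ring. Qed.
Let g1h : g1 * h = V * u2 * G.
Proof. by rewrite -mulrA -a21 /h /super_vandermonde /V; ring. Qed.
Let g2h : g2 * h = V * u1 * G.
Proof. by rewrite -mulrA -a12 /h /super_vandermonde /V; ring. Qed.

Let h1E' : D1 h = V1 * (g1 * g2) + V * x1 * (g1 * g1 * g2).
Proof. by rewrite /h /super_vandermonde !d1rules /V /V1; ring. Qed.
Let h1E : D1 h = (V1 * u1 + V * x1) * u2 * G.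
Proof. by rewrite h1E' a11 a21; ring. Qed.
Let h2E' : D2 h = V2 * (g1 * g2) + V * x2 * (g1 * (g2 * g2)).
Proof. by rewrite /h /super_vandermonde !d2rules /V /V2; ring. Qed.
Let h2E : D2 h = (V2 * u2 + V * x2) * u1 * G.
Proof. by rewrite h2E' a11 a12; ring. Qed.
Let hwE' : Dw h = Vw * (g1 * g2).
Proof. by rewrite /h /super_vandermonde !dwrules /Vw; ring. Qed.
Let hwE : Dw h = Vw * u1 * u2 * G.
Proof. by rewrite hwE' a11; ring. Qed.
Let h12E : D1 (D2 h) = ((V12 * u1 + V2 * x1) * u2 + (V1 * u1 + V * x1) * x2) * G.
Proof.
rewrite h2E'; transitivity (V12 * (g1 * g2) + V2 * x1 * (g1 * g1 * g2)
  + V1 * x2 * (g1 * (g2 * g2)) + V * x1 * x2 * ((g1 * g1) * (g2 * g2))).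
  by rewrite /V /V1 /V2 /V12 !d1rules; ring.
by rewrite a11 a21 a12 -/G; ring.
Qed.
Let h1wE : D1 (Dw h) = (V1w * u1 + Vw * x1) * u2 * G.
Proof.
rewrite hwE'; transitivity (V1w * (g1 * g2) + Vw * x1 * (g1 * g1 * g2)).
  by rewrite /Vw /V1w !d1rules; ring.
by rewrite a11 a21; ring.
Qed.
Let h2wE : D2 (Dw h) = (V2w * u2 + Vw * x2) * u1 * G.
Proof.
rewrite hwE'; transitivity (V2w * (g1 * g2) + Vw * x2 * (g1 * (g2 * g2))).
  by rewrite /Vw /V2w !d2rules; ring.
by rewrite a11 a12; ring.
Qed.

Let X := h * W.

(* Only mixed second derivatives survive, and [N + 1 - D1 - D2] is the degree
   [k] of the remaining variables: on each monomial in [x1], [x2] the operator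
   is a scalar plus [k * Dw]. *)
Lemma super_laplacian :
  (w - 1) * (h * M) =
  (w - 1) * (- ((N + 1) * (N + 2) + 2 * N) * X + 2 * (N + 1) * (D1 X + D2 X + Dw X)
    - 2 * (D1 (D2 X) + D1 (Dw X) + D2 (Dw X)))
  - 2 * w * ((N + 1) * X - D1 X - D2 X).
Proof.
have e1 : D1 X = D1 h * W + h * A1 by exact: derivationM.
have e2 : D2 X = D2 h * W + h * A2 by exact: derivationM.
have ew : Dw X = Dw h * W + h * Aw by exact: derivationM.
have e12 : D1 (D2 X) = D1 (D2 h) * W + D2 h * A1 + D1 h * A2 + h * D1 A2.
  by rewrite e2 !(derivationD der1, derivationM der1) -/A1; ring.
have e1w : D1 (Dw X) = D1 (Dw h) * W + Dw h * A1 + D1 h * Aw + h * D1 Aw.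
  by rewrite ew !(derivationD der1, derivationM der1) -/A1; ring.
have e2w : D2 (Dw X) = D2 (Dw h) * W + Dw h * A2 + D2 h * Aw + h * D2 Aw.
  by rewrite ew !(derivationD der2, derivationM der2) -/A2; ring.
have t12 := tauE x1 x2; have t1w := tauE x1 w; have t2w := tauE x2 w.
have t1 := tauE1 x1; have t2 := tauE1 x2; have tw := tauE1 w.
rewrite -?A1E -?A2E -?AwE in t12 t1w t2w t1 t2 tw.
(* Here [1 - x1] can be inverted, and [1 - x2] below; [tau w 1] is only known after multiplication
   by [w - 1], which is why the statement carries this factor. *)
have {}t1 : tau x1 1 = - (g1 * (A1 + x1 * Av)).
  by rewrite -t1 -[LHS]mul1r -{1}g1_inv; ring.
have {}t2 : tau x2 1 = - (g2 * (A2 + x2 * Av)).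
  by rewrite -t2 -[LHS]mul1r -{1}g2_inv; ring.
(* Each [tau a b] takes from [h] the factor [a - b] that makes [tauE] applicable. *)
transitivity ((w - 1) * h * (- N * (N - 1) * W + 2 * (N - 1) * (A1 + A2 + Aw)
   - 2 * (D1 A2 + D1 Aw + D2 Aw))
  + 2 * (w - 1) * (x1 - w) * (x2 - w) * (g1 * g2) * ((x1 - x2) * tau x1 x2)
  + 2 * (w - 1) * (x1 - x2) * (x2 - w) * (g1 * g2) * ((x1 - w) * tau x1 w)
  + 2 * (w - 1) * (x1 - x2) * (x1 - w) * (g1 * g2) * ((x2 - w) * tau x2 w)
  + 2 * (w - 1) * ((g1 * h) * (A1 + x1 * Av) + (g2 * h) * (A2 + x2 * Av))
  - 2 * h * ((w - 1) * tau w 1)).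
  by rewrite ME t1 t2 /h /super_vandermonde; ring.
rewrite t12 t1w t2w tw g1h g2h e12 e1w e2w e1 e2 ew h12E h1wE h2wE h1E h2E hwE.
rewrite /X hE a11 /Av /V /V1 /V2 /Vw /V12 /V1w /V2w /u1 /u2.
by ring.
Qed.

End SuperLaplacian.

(** * Power series in two variables: coefficients and order *)

Section SeriesAlgebra.
Variable K : comNzRingType.

Lemma pser_natME n (f : pser K) i : (n%:R * f) i = n%:R * f i.
Proof. by rewrite !mulr_natl pserMnE. Qed.

Lemma pser_map_rmorphM (L : comNzRingType) (u : {rmorphism K -> L}) (f g : pser K) :
  pser_map u (f * g) = (pser_map u f : pser L) * pser_map u g.
Proof.
apply/funext => n; rewrite pserME /pser_map pserME rmorph_sum.
by apply: eq_bigr => i _; rewrite rmorphM.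
Qed.

Fact pser_map_is_zmod_morphism (L : comNzRingType) (u : {rmorphism K -> L}) :
  zmod_morphism (pser_map u : pser K -> pser L).
Proof. by move=> f g; apply/funext => n; rewrite pserBE /pser_map pserBE rmorphB. Qed.

Fact pser_map_is_monoid_morphism (L : comNzRingType) (u : {rmorphism K -> L}) :
  monoid_morphism (pser_map u : pser K -> pser L).
Proof.
split; last exact: pser_map_rmorphM.
by apply/funext => n; rewrite /pser_map !pser1E rmorph_nat.
Qed.

HB.instance Definition _ (L : comNzRingType) (u : {rmorphism K -> L}) :=
  GRing.isZmodMorphism.Build (pser K) (pser L) (pser_map u)
      (pser_map_is_zmod_morphism u).
HB.instance Definition _ (L : comNzRingType) (u : {rmorphism K -> L}) :=
  GRing.isMonoidMorphism.Build (pser K) (pser L) (pser_map u)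
      (pser_map_is_monoid_morphism u).

Local Notation K2 := (pser (pser K)).

Lemma pser2_ext (f g : K2) : (forall i j, f i j = g i j) -> f = g.
Proof. by move=> e; apply/funext => i; apply/funext => j. Qed.

Lemma pser2_1E i j : (1 : K2) i j = ((i == 0%N) && (j == 0%N))%:R.
Proof. by rewrite pser1E; case: i => [|i] //=; rewrite pser1E. Qed.

(** The outer series variable is [x1] and the inner one [x2], so that [f i j] is the coefficient of
    [x1^i x2^j]. *)
Definition x1 : K2 := pserX _.
Definition x2 : K2 := pserC (pserX K).
Definition geom1 : K2 := pser_geom _.
Definition geom2 : K2 := pserC (pser_geom K).
Definition pserCC (c : K) : K2 := pserC (pserC c).

Lemma geom1_inv : (1 - x1) * geom1 = 1. Proof. exact: pser_geom_inv. Qed.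
Lemma geom2_inv : (1 - x2) * geom2 = 1.
Proof. by rewrite /x2 /geom2 -(rmorph1 (@pserC _)) -rmorphB -rmorphM pser_geom_inv. Qed.

Lemma pserCCME c (f : K2) i j : (pserCC c * f) i j = c * f i j.
Proof. by rewrite /pserCC !pserCME. Qed.

Lemma x1ME (f : K2) i j : (x1 * f) i j = if i is i'.+1 then f i' j else 0.
Proof. by rewrite pserXME; case: i. Qed.
Lemma x2ME (f : K2) i j : (x2 * f) i j = if j is j'.+1 then f i j' else 0.
Proof. by rewrite pserCME pserXME. Qed.
Lemma x1nME m (f : K2) i j :
  (x1 ^+ m * f) i j = if (m <= i)%N then f (i - m)%N j else 0.
Proof. by rewrite pserXnME; case: ifP. Qed.
Lemma x2nME m (f : K2) i j :
  (x2 ^+ m * f) i j = if (m <= j)%N then f i (j - m)%N else 0.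
Proof. by rewrite -rmorphXn pserCME pserXnME. Qed.
Lemma geom1ME (f : K2) i j : (geom1 * f) i j = \sum_(l < i.+1) f l j.
Proof. by rewrite pser_geomME pser_sumE. Qed.
Lemma geom2ME (f : K2) i j : (geom2 * f) i j = \sum_(l < j.+1) f i l.
Proof. by rewrite pserCME pser_geomME. Qed.
Lemma pser2_natME n (f : K2) i j : (n%:R * f) i j = n%:R * f i j.
Proof. by rewrite !mulr_natl !pserMnE. Qed.
Lemma pser2DE (f g : K2) i j : (f + g) i j = f i j + g i j. Proof. by []. Qed.
Lemma pser2BE (f g : K2) i j : (f - g) i j = f i j - g i j. Proof. by []. Qed.
Lemma pser2NE (f : K2) i j : (- f) i j = - f i j. Proof. by []. Qed.

Definition has_order d (f : K2) := forall i j, (i + j < d)%N -> f i j = 0.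

Lemma has_orderM d e (f g : K2) :
  has_order d f -> has_order e g -> has_order (d + e)%N (f * g).
Proof.
move=> fd ge i j ij; rewrite pserME pser_sumE big1 // => l _.
rewrite pserME big1 // => r _.
have [lr|lr] := ltnP (l + r) d; first by rewrite fd ?mul0r.
by rewrite ge ?mulr0 //; have := ltn_ord l; have := ltn_ord r; lia.
Qed.

Lemma has_order0 f : has_order 0 f. Proof. by []. Qed.

Lemma has_orderB d (f g : K2) :
  has_order d f -> has_order d g -> has_order d (f - g).
Proof. by move=> fd gd i j ij; rewrite pser2BE fd ?gd ?subr0. Qed.

Lemma has_order_x1 : has_order 1 x1.
Proof. by move=> [|i] [|j]. Qed.
Lemma has_order_x2 : has_order 1 x2.
Proof. by move=> [|i] [|j]. Qed.

End SeriesAlgebra.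

(** * Symmetric forms in two variables and their value at (1, 1) *)

Section HomogeneousSymmetric.
Variable K : comNzRingType.

(* Homogeneous of degree [d], symmetric, of value [c] at [x1 = x2 = 1]. *)
Definition homsym d (c : K) (f : pser (pser K)) :=
  [/\ forall i j, (i + j)%N != d -> f i j = 0,
      forall i j, f i j = f j i &
      \sum_(j < d.+1) f (d - j)%N j = c].

Lemma homsym1 : homsym 0 1 1.
Proof.
split=> [i j|i j|]; last by rewrite big_ord1.
  by rewrite pser1E; case: i j => [|i] [|j].
by rewrite !pser1E; case: i j => [|i] [|j].
Qed.

Lemma homsym_mul m d c f :
  homsym d c f -> homsym (m + d)%N (2 * c) ((x1 K ^+ m + x2 K ^+ m) * f).
Proof.
move=> [h0 hs hc]; split=> [i j ij|i j|].
- rewrite mulrDl pser2DE x1nME x2nME.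
  by case: leqP => mi; case: leqP => mj; rewrite ?h0 ?addr0 //; lia.
- by rewrite mulrDl !pser2DE !x1nME !x2nME addrC !(hs (_ - _)%N).
- under eq_bigr do rewrite mulrDl pser2DE x1nME x2nME.
  rewrite big_split /= mulr2n mulrDl mul1r; congr (_ + _).
    rewrite (@big_ord_widen _ _ _ d.+1 (m + d).+1 (fun j => f (d - j)%N j)) in hc;
        last by lia.
    rewrite -hc [RHS]big_mkcond /=; apply: eq_bigr => j _.
    have := ltn_ord j; rewrite ltnS => jmd.
    have -> : (m <= m + d - j)%N = (j < d.+1)%N by apply/idP/idP; lia.
    case: ltnP => // jd. by congr (f _ _); lia.
  rewrite -addnS big_split_ord /= big1 ?add0r => [|j _]; last first.
    by case: leqP => //; have := ltn_ord j; lia.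
  rewrite -hc; apply: eq_bigr => j _; rewrite leq_addr.
  by congr (f _ _); have := ltn_ord j; lia.
Qed.

Lemma homsym_prod (I : Type) (r : seq I) (P : pred I) (m : I -> nat) :
  homsym (\sum_(i <- r | P i) m i)%N (2 ^+ (\sum_(i <- r | P i) 1)%N)
    (\prod_(i <- r | P i) (x1 K ^+ m i + x2 K ^+ m i)).
Proof.
elim: r => [|i r ih]; first by rewrite !big_nil; exact: homsym1.
rewrite !big_cons; case: ifP => // _.
by rewrite exprS; exact: homsym_mul.
Qed.

Lemma homsym_order d c f : homsym d c f -> has_order d f.
Proof. by move=> [h _ _] i j ij; rewrite h // ltn_eqF. Qed.

(* Abel summation: by symmetry the half sum sees every coefficient once. *)
Lemma half_sum_symmetric d (e : nat -> K) :
  (forall j, (j <= d)%N -> e (d - j)%N = e j) ->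
  \sum_(0 <= b < d./2.+1) (d - b.*2).+1%:R *
     (e b - (if b is b'.+1 then e b' else 0)) = \sum_(0 <= j < d.+1) e j.
Proof.
move=> he; have abel h : (h.*2 <= d)%N ->
    \sum_(0 <= b < h.+1) (d - b.*2).+1%:R *
       (e b - (if b is b'.+1 then e b' else 0)) =
    2 * (\sum_(0 <= b < h) e b) + (d - h.*2).+1%:R * e h.
  elim: h => [|h ih] hd; first by rewrite big_nat1 big_geq // mulr0 add0r subr0.
  rewrite big_nat_recr //= ih; last by lia.
  rewrite [in RHS]big_nat_recr //=.
  have -> : (d - h.*2).+1 = ((d - h.+1.*2).+1 + 2)%N by lia.
  by rewrite natrD; ring.
have rev k : (k <= d.+1)%N -> \sum_(d.+1 - k <= j < d.+1) e j = \sum_(0 <= j < k) e j.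
  move=> kd; rewrite -{1}[(d.+1 - k)%N]add0n big_addn subKn // big_nat_rev /=.
  apply: eq_big_nat => j /andP[_ jk]; rewrite -(he j); last by lia.
  by congr e; lia.
rewrite abel; last by lia.
have dE := odd_double_half d; set h := d./2 in dE *.
rewrite [RHS](big_cat_nat _ (n := h)) //=; last by lia.
(* For odd [d] every term of the half sum has weight 2; for even [d] the middle coefficient is its
   own mirror image and has weight 1. *)
case: (odd d) dE => /= dE.
  rewrite [X in _ = _ + X]big_ltn; last by lia.
  have := rev h.+1; rewrite (_ : d.+1 - h.+1 = h.+1)%N; last by lia.
  move=> ->; last by lia.
  rewrite big_nat_recr //= (_ : (d - h.*2).+1 = 2%N); last by lia.
  by ring.
rewrite [X in _ = _ + X]big_ltn; last by lia.
have := rev h; rewrite (_ : d.+1 - h = h.+1)%N; last by lia.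
move=> ->; last by lia.
rewrite (_ : (d - h.*2).+1 = 1%N); last by lia.
by ring.
Qed.

(** The difference is the coefficient of [x1^(d-b+1) x2^b] in [(x1 - x2) f], the multiplicity in [f]
    of the Schur polynomial with rows [d - b] and [b], whose value at (1, 1) is [d - 2b + 1]. *)
Lemma homsym_half_sum d c f : homsym d c f ->
  \sum_(0 <= b < d./2.+1) (d - b.*2).+1%:R *
     (f (d - b)%N b - (if b is b'.+1 then f (d - b')%N b' else 0)) = c.
Proof.
move=> [h0 hs <-]; rewrite -(big_mkord xpredT (fun j => f (d - j)%N j)).
rewrite -(half_sum_symmetric (e := fun j => f (d - j)%N j)).
  by apply: eq_bigr => -[|b].
by move=> j jd; rewrite subKn // hs.
Qed.

End HomogeneousSymmetric.

(** * The alternant as a series in [x1], [x2] over polynomials in [w] *)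

Section TwoRowSeries.
Variables (R : numFieldType) (T : finType).
Implicit Types (s : {perm T}).
Local Notation K := {poly R}.
Local Notation K2 := (pser (pser K)).
Local Notation n := #|T|.

HB.instance Definition _ (L : comNzRingType) :=
  GRing.RMorphism.copy (@pserCC L) (@pserC (pser L) \o @pserC L).

Definition xw : K2 := pserCC 'X.
Definition polyXderiv (q : K) : K := 'X * q^`().
Definition euler1 : K2 -> K2 := @pser_deriv (pser K).
Definition euler2 : K2 -> K2 := pser_map (@pser_deriv K).
Definition eulerw : K2 -> K2 := pser_map (pser_map polyXderiv).

Lemma euler1E f i j : euler1 f i j = i%:R * f i j.
Proof. by rewrite /euler1 /pser_deriv pser_natME. Qed.
Lemma euler2E f i j : euler2 f i j = j%:R * f i j. Proof. by []. Qed.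
Lemma eulerwE f i j : eulerw f i j = 'X * (f i j)^`(). Proof. by []. Qed.

Lemma euler1_derivation : derivation euler1. Proof. exact: pser_deriv_derivation. Qed.
Lemma euler2_derivation : derivation euler2.
Proof. exact/pser_map_derivation/pser_deriv_derivation. Qed.
Lemma eulerw_derivation : derivation eulerw.
Proof.
do 2!apply: pser_map_derivation; split=> a b; rewrite /polyXderiv.
  by rewrite derivD mulrDr.
by rewrite derivM; ring.
Qed.

Lemma x1E (L : comNzRingType) i j :
  x1 L i j = ((i == 1%N) && (j == 0%N))%:R.
Proof. by rewrite /x1 /pserX; case: (i == 1%N); rewrite ?pser1E. Qed.
Lemma x2E (L : comNzRingType) i j :
  x2 L i j = ((i == 0%N) && (j == 1%N))%:R.
Proof. by rewrite /x2 /pserC; case: i. Qed.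
Lemma pserCCE (L : comNzRingType) (c : L) i j :
  pserCC c i j = if (i == 0%N) && (j == 0%N) then c else 0.
Proof. by rewrite /pserCC /pserC; case: i. Qed.

Definition super_power_sum (m : nat) : K2 := x1 K ^+ m + x2 K ^+ m + xw ^+ m - 1.
Definition cycle_series s : K2 := cyc_prod super_power_sum s.
Definition vandermonde_series : K2 := super_vandermonde (x1 K) (x2 K) xw (geom1 K)
    (geom2 K).
Definition alternant_series s : K2 := vandermonde_series * cycle_series s.

Lemma euler1_x1 : euler1 (x1 K) = x1 K.
Proof. by apply: pser2_ext => i j; rewrite euler1E x1E; case: i => [|[|i]];
    rewrite ?mul0r ?mul1r ?mulr0. Qed.
Lemma euler1_x2 : euler1 (x2 K) = 0.
Proof. by apply: pser2_ext => i j; rewrite euler1E x2E; case: i => [|i];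
    rewrite ?mul0r ?mulr0. Qed.
Lemma euler1_xw : euler1 xw = 0.
Proof. by apply: pser2_ext => i j; rewrite euler1E /xw pserCCE; case: i => [|i];
    rewrite ?mul0r ?mulr0. Qed.
Lemma euler2_x1 : euler2 (x1 K) = 0.
Proof. by apply: pser2_ext => i j; rewrite euler2E x1E; case: j => [|j];
    rewrite ?mul0r ?andbF ?mulr0. Qed.
Lemma euler2_x2 : euler2 (x2 K) = x2 K.
Proof. by apply: pser2_ext => i j; rewrite euler2E x2E; case: j => [|[|j]];
    rewrite ?mul0r ?mul1r ?andbF ?mulr0. Qed.
Lemma euler2_xw : euler2 xw = 0.
Proof. by apply: pser2_ext => i j; rewrite euler2E /xw pserCCE; case: j => [|j];
    rewrite ?mul0r ?andbF ?mulr0. Qed.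
Lemma eulerw_x1 : eulerw (x1 K) = 0.
Proof. by apply: pser2_ext => i j; rewrite eulerwE x1E; case: andb;
    rewrite ?derivC ?linear0 ?mulr0 // -polyC1 derivC mulr0. Qed.
Lemma eulerw_x2 : eulerw (x2 K) = 0.
Proof. by apply: pser2_ext => i j; rewrite eulerwE x2E; case: andb;
    rewrite ?derivC ?linear0 ?mulr0 // -polyC1 derivC mulr0. Qed.
Lemma eulerw_xw : eulerw xw = xw.
Proof. by apply: pser2_ext => i j; rewrite eulerwE /xw pserCCE; case: ifP => _;
    rewrite ?derivX ?mulr1 // linear0 mulr0. Qed.

Lemma euler12C f : euler2 (euler1 f) = euler1 (euler2 f).
Proof. by apply: pser2_ext => i j; rewrite !(euler1E, euler2E) mulrCA. Qed.
Lemma euler1wC f : eulerw (euler1 f) = euler1 (eulerw f).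
Proof. by apply: pser2_ext => i j; rewrite !(euler1E, eulerwE) !mulr_natl derivMn
    mulrnAr. Qed.
Lemma euler2wC f : eulerw (euler2 f) = euler2 (eulerw f).
Proof. by apply: pser2_ext => i j; rewrite !(euler2E, eulerwE) !mulr_natl derivMn
    mulrnAr. Qed.

Lemma alternant_series_laplacian s i j k : (i + j + k = n.+1)%N ->
  ('X - 1) * (\sum_x \sum_(y | y != x) alternant_series (s * tperm x y)%g i j) =
  ('X - 1) * (((n%:R + 1) * (n%:R - 2 * k%:R) - 2 * n%:R - 2 * (i%:R * j%:R)) *
      alternant_series s i j
     + 2 * k%:R * ('X * (alternant_series s i j)^`()))
  - 2 * k%:R * ('X * alternant_series s i j).
Proof.
move=> ijk.
have lap : (xw - 1) * (vandermonde_series * \sum_x \sum_(y | y != x) cyc_prod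
    super_power_sum (s * tperm x y)%g) =
  (xw - 1) * (- ((n%:R + 1) * (n%:R + 2) + 2 * n%:R) * alternant_series s
    + 2 * (n%:R + 1) * (euler1 (alternant_series s) + euler2 (alternant_series s) +
        eulerw (alternant_series s))
    - 2 * (euler1 (euler2 (alternant_series s)) + euler1 (eulerw (alternant_series
        s)) + euler2 (eulerw (alternant_series s))))
  - 2 * xw * ((n%:R + 1) * alternant_series s - euler1 (alternant_series s) -
      euler2 (alternant_series s)).
  exact: (super_laplacian euler1_derivation euler2_derivation eulerw_derivation
    euler1_x1 euler1_x2 euler1_xw euler2_x1 euler2_x2 euler2_xw eulerw_x1 eulerw_x2
        eulerw_xw
    euler12C euler1wC euler2wC (geom1_inv K) (geom2_inv K) s).
have sumE : \sum_x \sum_(y | y != x) alternant_series (s * tperm x y)%g =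
    vandermonde_series * \sum_x \sum_(y | y != x) cyc_prod super_power_sum (s *
        tperm x y)%g.
  by rewrite mulr_sumr; apply: eq_bigr => x _; rewrite mulr_sumr.
rewrite -sumE in lap.
have {}lap : pserCC ('X - 1) * (\sum_x \sum_(y | y != x) alternant_series (s *
    tperm x y)%g) =
   pserCC ('X - 1) * (pserCC (- ((n%:R + 1) * (n%:R + 2) + 2 * n%:R)) *
       alternant_series s
     + pserCC (2 * (n%:R + 1)) * (euler1 (alternant_series s) + euler2
         (alternant_series s) + eulerw (alternant_series s))
     - pserCC 2 * (euler1 (euler2 (alternant_series s)) + euler1 (eulerw
         (alternant_series s)) + euler2 (eulerw (alternant_series s))))
   - pserCC (2 * 'X) * (pserCC (n%:R + 1) * alternant_series s - euler1
       (alternant_series s) - euler2 (alternant_series s)).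
  by rewrite !(rmorphB, rmorphN, rmorphD, rmorphM, rmorph_nat, rmorph1).
have := congr1 (fun f : K2 => f i j) lap.
rewrite !(pserCCME, pser2DE, pser2NE, euler1E, euler2E, eulerwE) !pser_sumE.
under eq_bigr do rewrite !pser_sumE.
move=> ->.
have nE : n%:R = i%:R + j%:R + k%:R - 1 :> K.
  by rewrite -!natrD ijk -natr1 addrK.
by rewrite nE; ring.
Qed.

End TwoRowSeries.

(** * Division by [w - 1] and the value at [w = 1] *)

Section EvaluationAtOne.
Variables (R : numFieldType) (T : finType).
Implicit Types (s : {perm T}).
Local Notation K := {poly R}.
Local Notation K2 := (pser (pser K)).
Local Notation S2 := (pser (pser R)).
Local Notation n := #|T|.

Definition eval1 : {rmorphism K2 -> S2} :=
  pser_map (pser_map (horner_eval (1 : R)) : {rmorphism pser K -> pser R}).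

Lemma eval1E (f : K2) i j : eval1 f i j = (f i j).[1]. Proof. by []. Qed.

Lemma eval1_x1 : eval1 (x1 K) = x1 R.
Proof. by apply: pser2_ext => i j; rewrite eval1E !x1E -polyC_natr hornerC. Qed.
Lemma eval1_x2 : eval1 (x2 K) = x2 R.
Proof. by apply: pser2_ext => i j; rewrite eval1E !x2E -polyC_natr hornerC. Qed.
Lemma eval1_xw : eval1 (xw R) = 1.
Proof.
apply: pser2_ext => i j; rewrite eval1E /xw pserCCE pser2_1E.
by case: ifP => _; rewrite ?hornerX ?horner0.
Qed.
Lemma eval1_geom1 : eval1 (geom1 K) = geom1 R.
Proof.
apply: pser2_ext => i j; rewrite eval1E /geom1 /pser_geom !pser1E.
by rewrite -polyC_natr hornerC.
Qed.
Lemma eval1_geom2 : eval1 (geom2 K) = geom2 R.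
Proof.
apply: pser2_ext => i j; rewrite eval1E /geom2 /pser_geom /pserC.
by case: i => [|i] /=; rewrite ?hornerC ?horner0.
Qed.

Lemma eval1_vandermonde_series : eval1 (vandermonde_series R) = x1 R - x2 R.
Proof.
rewrite /vandermonde_series /super_vandermonde !(rmorphM, rmorphB).
rewrite eval1_x1 eval1_x2 eval1_xw eval1_geom1 eval1_geom2.
transitivity ((x1 R - x2 R) * ((1 - x1 R) * geom1 R) * ((1 - x2 R) * geom2 R)).
  by ring.
by rewrite geom1_inv geom2_inv !mulr1.
Qed.

Lemma eulerw_geom1 : eulerw (geom1 K) = 0.
Proof.
apply: pser2_ext => i j; rewrite eulerwE /geom1 /pser_geom pser1E.
by rewrite -polyC_natr derivC mulr0.
Qed.
Lemma eulerw_geom2 : eulerw (geom2 K) = 0.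
Proof.
apply: pser2_ext => i j; rewrite eulerwE /geom2 /pser_geom /pserC.
by case: i => [|i] /=; rewrite -?polyC1 ?derivC ?linear0 ?mulr0 // derivC mulr0.
Qed.

(** The factor [x1 - x2] does not involve [w] and survives the differentiation. It raises the order
    by one, enough to hide this term in total degree at most n. *)
Lemma eval1_eulerw_vandermonde :
  exists f, eval1 (eulerw (vandermonde_series R)) = (x1 R - x2 R) * f.
Proof.
have der := eulerw_derivation R.
have -> : eulerw (vandermonde_series R) = (x1 K - x2 K) *
    (- xw R * ((x2 K - xw R) + (x1 K - xw R)) * (geom1 K * geom2 K)).
  rewrite /vandermonde_series /super_vandermonde !(derivationM der, derivationB der).
  by rewrite eulerw_x1 eulerw_x2 eulerw_xw eulerw_geom1 eulerw_geom2; ring.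
by rewrite rmorphM rmorphB eval1_x1 eval1_x2; eexists.
Qed.

Definition power_sum2 (m : nat) : S2 := x1 R ^+ m + x2 R ^+ m.

Lemma eval1_super_power_sum m : eval1 (super_power_sum R m) = power_sum2 m.
Proof.
rewrite /super_power_sum rmorphB !rmorphD !rmorphXn eval1_x1 eval1_x2 eval1_xw.
by rewrite rmorph1 expr1n addrK.
Qed.

Lemma eval1_cycle_series s : eval1 (cycle_series R s) = cyc_prod power_sum2 s.
Proof. by rewrite rmorph_prod; apply: eq_bigr => C _;
    rewrite eval1_super_power_sum. Qed.

Lemma eval1_eulerw_cycle_series s : eval1 (eulerw (cycle_series R s)) = cyc_sum1
    power_sum2 (fun m => m%:R) s.
Proof.
have der := eulerw_derivation R.
rewrite (derivation_cyc_prod _ _ der) rmorph_sum; apply: eq_bigr => C _.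
rewrite rmorphM rmorph_prod; congr (_ * _).
  have e1 : eulerw (x1 K ^+ #|C|) = 0 by rewrite (derivationX der) eulerw_x1 mulr0.
  have e2 : eulerw (x2 K ^+ #|C|) = 0 by rewrite (derivationX der) eulerw_x2 mulr0.
  have ew := derivation_Xeigen der #|C| (eulerw_xw R).
  rewrite /= /super_power_sum (derivationB der) !(derivationD der) (derivation1 der).
  rewrite e1 e2 ew !add0r subr0.
  by rewrite rmorphM rmorphXn eval1_xw expr1n mulr1 rmorph_nat.
by apply: eq_bigr => D _; rewrite eval1_super_power_sum.
Qed.

Lemma sum_card_porbits s : (\sum_(C in porbits s) #|C|)%N = n.
Proof.
apply/eqP; rewrite -(eqr_nat int) natr_sum; apply/eqP.
under eq_bigr do rewrite -[_%:R]mulr1.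
by rewrite -(sum_porbit s (fun=> 1 : int)) sumr_const.
Qed.

Lemma homsym_cyc_prod s : homsym n (2 ^+ #|porbits s|) (cyc_prod power_sum2 s).
Proof.
rewrite -(sum_card_porbits s) -[X in _ ^+ X]sum1_card.
exact: (homsym_prod R (index_enum _) (mem (porbits s)) (fun C : {set T} => #|C|)).
Qed.

Lemma homsym_cyc_prod_other s C : C \in porbits s ->
  homsym (n - #|C|)%N (2 ^+ #|porbits s|.-1)
    (\prod_(D in porbits s | D != C) power_sum2 #|D|).
Proof.
move=> CP; rewrite -(sum_card_porbits s) -[#|porbits s|]sum1_card (bigD1 C) //= addKn.
rewrite [X in _ ^+ X.-1](bigD1 C) //= add0n.
exact: (homsym_prod R (index_enum _) (fun D => (D \in porbits s) && (D != C))
  (fun D : {set T} => #|D|)).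
Qed.

(** At [w = 1] there remains [x1 - x2] times a form of degree n, which has no coefficient below
    degree n + 1. *)
Lemma alternant_series_root s i j : (i + j <= n)%N -> (alternant_series R s i
    j).[1] = 0.
Proof.
move=> ij; rewrite -eval1E /alternant_series rmorphM eval1_vandermonde_series
    eval1_cycle_series.
have /homsym_order ordW := homsym_cyc_prod s.
apply: (has_orderM (has_orderB (@has_order_x1 R) (@has_order_x2 R)) ordW).
by rewrite add1n ltnS.
Qed.

(* The division is exact only for [i + j <= n], by [reduced_alternantE]. *)
Definition reduced_alternant s i j : K := alternant_series R s i j %/ ('X - 1).

Lemma reduced_alternantE s i j : (i + j <= n)%N -> alternant_series R s i j = ('X -
    1) * reduced_alternant s i j.
Proof.
move=> ij; rewrite mulrC divpK // -polyC1 dvdp_XsubCl.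
by apply/eqP; exact: alternant_series_root.
Qed.

(** In the law for [('X - 1) * A], the derivative that falls on ['X - 1] cancels the last term. Two
    factors ['X - 1] then drop out, that of the law and that of the alternant. *)
Lemma reduced_alternant_laplacian s i j k : (i + j + k = n.+1)%N -> (0 < k)%N ->
  \sum_x \sum_(y | y != x) reduced_alternant (s * tperm x y)%g i j =
  ((n%:R + 1) * (n%:R - 2 * k%:R) - 2 * n%:R - 2 * (i%:R * j%:R)) *
      reduced_alternant s i j
  + 2 * k%:R * ('X * (reduced_alternant s i j)^`()).
Proof.
move=> ijk k0; have ij : (i + j <= n)%N by lia.
have X1 : ('X - 1 : K) != 0 by rewrite -polyC1 polyXsubC_eq0.
apply: (mulfI X1); apply: (mulfI X1).
have := alternant_series_laplacian R s ijk.
have -> : \sum_x \sum_(y | y != x) alternant_series R (s * tperm x y)%g i j =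
   ('X - 1) * \sum_x \sum_(y | y != x) reduced_alternant (s * tperm x y)%g i j.
  rewrite mulr_sumr; apply: eq_bigr => x _; rewrite mulr_sumr.
  by apply: eq_bigr => y _; rewrite reduced_alternantE.
by rewrite reduced_alternantE // derivM derivB derivX -polyC1 derivC polyC1 => ->; ring.
Qed.

(** The rule of l'Hospital: the quotient by ['X - 1] takes at 1 the value of the derivative of the
    alternant. The term where the Vandermonde factor is differentiated has too high an order to
    contribute. *)
Lemma reduced_alternant_at1 s i j : (i + j <= n)%N ->
  (reduced_alternant s i j).[1] = ((x1 R - x2 R) * cyc_sum1 power_sum2 (fun m =>
      m%:R) s) i j.
Proof.
move=> ij.
have -> : (reduced_alternant s i j).[1] = eval1 (eulerw (alternant_series R s)) i j.
  rewrite eval1E eulerwE reduced_alternantE // derivM derivB derivX -polyC1 derivC.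
  by rewrite !hornerE; ring.
have -> : eval1 (eulerw (alternant_series R s)) =
    eval1 (eulerw (vandermonde_series R)) * eval1 (cycle_series R s) + eval1
        (vandermonde_series R) * eval1 (eulerw (cycle_series R s)).
  by rewrite /alternant_series (derivationM (eulerw_derivation R)) rmorphD;
      congr (_ + _); exact: rmorphM.
rewrite eval1_vandermonde_series eval1_eulerw_cycle_series eval1_cycle_series pser2DE.
have [f ->] := eval1_eulerw_vandermonde.
have /homsym_order ordW := homsym_cyc_prod s.
have ord := has_orderM (has_orderB (@has_order_x1 R) (@has_order_x2 R))
  (has_orderM (@has_order0 _ f) ordW).
by rewrite -mulrA ord ?add0r // add0n add1n ltnS.
Qed.

Lemma sum_reduced_alternant_at1 s k : (0 < k <= n)%N -> let d := (n - k)%N in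
  \sum_(0 <= b < d./2.+1) (d - b.*2).+1%:R * (reduced_alternant s (d - b).+1 b).[1] =
  k%:R * 2 ^+ #|porbits s|.-1 * #|[set C in porbits s | #|C| == k]|%:R.
Proof.
move=> /andP[k0 kn] d.
pose f C := \prod_(D in porbits s | D != C) power_sum2 #|D|.
have PhiC b : (b <= d./2)%N -> (reduced_alternant s (d - b).+1 b).[1] =
    \sum_(C in porbits s) #|C|%:R *
      (f C (d - b)%N b - (if b is b'.+1 then f C (d - b')%N b' else 0)).
  move=> bd; rewrite reduced_alternant_at1; last by lia.
  rewrite mulr_sumr !pser_sumE; apply: eq_bigr => C _.
  rewrite mulrCA pser2_natME mulrBl pser2BE x1ME x2ME; congr (_ * (_ - _)).
  case: b bd => // b bd; congr (f C _ _); lia.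
rewrite (eq_big_nat _ _ (F2 := fun b => \sum_(C in porbits s) #|C|%:R *
    ((d - b.*2).+1%:R * (f C (d - b)%N b - (if b is b'.+1 then f C (d - b')%N b'
        else 0))))); last first.
  move=> b /andP[_ bd]; rewrite PhiC // mulr_sumr.
  by apply: eq_bigr => C _; rewrite mulrCA.
rewrite exchange_big /= (eq_bigr (fun C : {set T} => if #|C| == k then k%:R * 2 ^+
    #|porbits s|.-1 else 0)).
  rewrite -big_mkcondr sumr_const -[LHS]mulr_natr.
  by congr (_ * _%:R); apply: eq_card => C; rewrite !inE.
move=> C CP; have hC := homsym_cyc_prod_other CP.
rewrite -mulr_sumr; case: eqP => [Ck|/eqP Ck].
  by rewrite Ck in hC *; rewrite (homsym_half_sum hC).
rewrite big_nat big1 ?mulr0 // => b /andP[_ bd].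
have Cn : (#|C| <= n)%N by exact: max_card.
have [h0 _ _] := hC.
rewrite /f h0; last by lia.
by case: b bd => [|b] bd; rewrite ?h0 ?subr0 ?mulr0 //; lia.
Qed.

End EvaluationAtOne.

(** * Initial values and incomplete beta integrals *)

Section IncompleteBeta.
Variable R : realType.
Implicit Types y : R.

Lemma Rintegral_poly_deriv (p q : {poly R}) y : y <= 1 -> p^`() = q ->
  \int[lebesgue_measure]_(x in `[y, 1%R]%classic) q.[x] = p.[1] - p.[y].
Proof.
rewrite le_eqVlt => /predU1P[->|y1] pq; first by rewrite set_itv1 Rintegral_set1 subrr.
rewrite /Rintegral (@continuous_FTC2 _ _ (horner p)) //=.
- by apply: continuous_subspaceT => x; exact: continuous_horner.
- split=> [x _||]; first exact: derivable_horner.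
    by apply: cvg_at_right_filter; exact: continuous_horner.
  by apply: cvg_at_left_filter; exact: continuous_horner.
- by move=> x _; rewrite -pq derivE.
Qed.

(** The probability of at most [m] successes in [N] trials of success probability [y]. *)
Definition binom_tail N m y : R :=
  \sum_(i < m.+1) 'C(N, i)%:R * (y ^+ i * (1 - y) ^+ (N - i)).

Let tail_poly N m : {poly R} :=
  \sum_(i < m.+1) 'C(N, i)%:R * ('X ^+ i * (1 - 'X) ^+ (N - i)).

Let tail_polyE N m y : (tail_poly N m).[y] = binom_tail N m y.
Proof.
rewrite horner_sum; apply: eq_bigr => i _.
by rewrite !(hornerM, horner_exp, hornerX, hornerD, hornerN, hornerC) -polyC_natr
    hornerC.
Qed.

Let deriv_tail N m : (m < N)%N ->
  (tail_poly N m)^`() =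
  - ((N - m)%:R * 'C(N, m)%:R * ('X ^+ m * (1 - 'X) ^+ (N - m.+1))).
Proof.
have d1X : (1 - 'X : {poly R})^`() = -1 by rewrite derivB -polyC1 derivC derivX sub0r.
elim: m => [|m ih] mN.
  rewrite /tail_poly big_ord1 bin0 !expr0 !mul1r !subn0 deriv_exp d1X.
  by rewrite subn1 !mulr1 mulr_natl mulNr mul1r mulNrn.
rewrite /tail_poly big_ord_recr /= derivD -/(tail_poly N m) ih; last exact: ltnW.
have dn k : (k%:R : {poly R})^`() = 0 by rewrite -polyC_natr derivC.
rewrite derivM dn mul0r add0r derivM derivXn deriv_exp d1X.
have -> : (N - m)%:R * 'C(N, m)%:R = m.+1%:R * 'C(N, m.+1)%:R :> {poly R}.
  by rewrite -!natrM mul_bin_left.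
have -> : (N - m.+1).-1 = (N - m.+2)%N by lia.
rewrite -(mulr_natl _ m.+1) -(mulr_natl _ (N - m.+1)) /=.
ring.
Qed.

(** The derivative of the tail telescopes to a single term, and as [m < N] the tail vanishes at
    1. *)
Lemma binom_tail_beta N m y : (m < N)%N -> y <= 1 ->
  binom_tail N m y = (N - m)%:R * 'C(N, m)%:R * inc_beta y m (N - m.+1).
Proof.
move=> mN y1; set c : R := _ * 'C(N, m)%:R.
have c0 : c != 0 by rewrite mulf_neq0 // pnatr_eq0 -lt0n ?subn_gt0 // bin_gt0 ltnW.
have -> : inc_beta y m (N - m.+1) =
    (- c^-1 *: tail_poly N m).[1] - (- c^-1 *: tail_poly N m).[y].
  rewrite -(Rintegral_poly_deriv (q := 'X ^+ m * (1 - 'X) ^+ (N - m.+1)) y1).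
    by apply: eq_Rintegral => x _; rewrite !(hornerE, horner_exp).
  rewrite derivZ deriv_tail // scalerN scaleNr opprK -!polyC_natr -polyCM.
  by rewrite -mul_polyC mulrA -polyCM mulVf // mul1r.
rewrite !hornerZ !tail_polyE.
have -> : binom_tail N m 1 = 0.
  rewrite /binom_tail big1 // => i _; rewrite subrr expr0n subn_eq0.
  by rewrite leqNgt (leq_ltn_trans (leq_ord i)) //= !mulr0.
by rewrite mulr0 sub0r mulNr opprK mulrA mulfV // mul1r.
Qed.

Lemma binom_tail_recr N m y :
  binom_tail N m.+1 y = binom_tail N m y + 'C(N, m.+1)%:R * (y ^+ m.+1 * (1 - y) ^+
      (N - m.+1)).
Proof. by rewrite /binom_tail big_ord_recr. Qed.

Lemma binom_tail0 N y : binom_tail N 0 y = (1 - y) ^+ N.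
Proof. by rewrite /binom_tail big_ord1 bin0 expr0 !mul1r subn0. Qed.

(** The last term is the probability that [N] trials give exactly [m] successes and a further trial
    succeeds. *)
Lemma binom_tailS N m y : (m <= N)%N ->
  binom_tail N m y = binom_tail N.+1 m y + 'C(N, m)%:R * (y ^+ m.+1 * (1 - y) ^+ (N
      - m)).
Proof.
elim: m => [|m ih] mN.
  by rewrite !binom_tail0 bin0 subn0 exprS expr1; ring.
rewrite !binom_tail_recr ih; last exact: ltnW.
rewrite binS natrD subSS.
have -> : (N - m = (N - m.+1).+1)%N by lia.
by rewrite !exprS; ring.
Qed.

End IncompleteBeta.

Section InitialValue.
Variable R : realType.
Local Notation K := {poly R}.
Local Notation K2 := (pser (pser K)).

Lemma pser_binomial (L : comNzRingType) (c : L) N j :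
  ((pserC c + pserX L) ^+ N) j = 'C(N, j)%:R * c ^+ (N - j).
Proof.
rewrite exprDn pser_sumE.
have E (i : 'I_N.+1) : (pserC c ^+ (N - i) * pserX L ^+ i *+ 'C(N, i)) j =
    if j == i :> nat then 'C(N, j)%:R * c ^+ (N - j) else 0.
  rewrite pserMnE -rmorphXn pserCME pserXnE.
  by case: eqP => [->|_]; rewrite ?mulr1 ?mulr0 ?mul0rn // mulr_natl.
rewrite (eq_bigr _ (fun i _ => E i)) -big_mkcond /=.
have [jN|jN] := ltnP j N.+1.
  by rewrite (big_pred1 (Ordinal jN)) // => i; rewrite eq_sym.
rewrite big_pred0 ?bin_small ?mul0r // => i.
by rewrite gtn_eqF // (leq_ltn_trans (leq_ord i)).
Qed.

Lemma card_porbits1 (T : finType) : #|porbits (1 : {perm T})| = #|T|.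
Proof.
rewrite -(sum_card_porbits (1 : {perm T})) -sum1_card; apply: eq_bigr => C.
case/imsetP => x _ ->; rewrite (@card_porbit_traject _ _ _ 1) //.
by rewrite /= perm1.
Qed.

Lemma card_porbit1 (T : finType) (C : {set T}) : C \in porbits (1 : {perm T}) ->
    #|C| = 1%N.
Proof.
by case/imsetP => x _ ->; rewrite (@card_porbit_traject _ _ _ 1) //= perm1.
Qed.

Variable T : finType.
Local Notation n := #|T|.

Definition trinom i j : nat := ('C(n, i) * 'C(n - i, j))%N.

Lemma trinomC i j : trinom i j = trinom j i.
Proof.
rewrite /trinom; have [ij|ij] := leqP (i + j) n; last first.
  have z a b : (n < a + b)%N -> ('C(n, a) * 'C(n - a, b) = 0)%N.
    move=> ab; have [an|an] := ltnP n a; first by rewrite bin_small.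
    by rewrite [X in (_ * X)%N]bin_small ?muln0 //; lia.
  by rewrite !z // addnC.
have fac a b : (a + b <= n)%N ->
    ('C(n, a) * 'C(n - a, b) * (a`! * b`! * (n - a - b)`!) = n`!)%N.
  move=> ab; rewrite -(@bin_fact n a); last by lia.
  by rewrite -(@bin_fact (n - a) b); [ring | lia].
have := fac _ _ ij; have ji : (j + i <= n)%N by rewrite addnC.
rewrite -(fac _ _ ji) (mulnC j`!) (_ : n - i - j = n - j - i)%N; last by lia.
by move/eqP; rewrite eqn_pmul2r ?muln_gt0 ?fact_gt0 // => /eqP.
Qed.

Lemma cycle_series1E i j :
  cycle_series R (1 : {perm T}) i j = (trinom i j)%:R * ('X - 1) ^+ (n - i - j).
Proof.
have -> : cycle_series R (1 : {perm T}) =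
    (pserC (pserC ('X - 1) + pserX K) + pserX (pser K)) ^+ n.
  rewrite /cycle_series /cyc_prod (eq_bigr (fun=> super_power_sum R 1)) => [|C
      /card_porbit1 -> //].
  rewrite prodr_const card_porbits1; congr (_ ^+ _).
  by rewrite /super_power_sum !expr1 rmorphD !rmorphB !rmorph1 /x1 /x2 /xw /pserCC;
      ring.
rewrite pser_binomial pser_natME pser_binomial.
by rewrite mulrA -natrM.
Qed.

(** The value [x1 - x2] of the Vandermonde factor at [w = 1] is split off; the rest is visibly
    divisible by [w - 1]. Each of the two geometric series then stands alone and produces partial
    sums in one index, the binomial tails. *)
Lemma alternant_partial_fractions (s : {perm T}) :
  alternant_series R s = (x1 K - x2 K) * cycle_series R s + (xw R - 1) *
    (geom1 K * ((xw R - x2 K) * cycle_series R s) + geom2 K * ((x1 K - xw R) *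
        cycle_series R s)).
Proof.
rewrite /alternant_series /vandermonde_series /super_vandermonde.
set W := cycle_series R s; set w := xw R.
transitivity ((x1 K - x2 K) * (((1 - x1 K) * geom1 K) * ((1 - x2 K) * geom2 K)) * W
  + (w - 1) * (geom1 K * ((1 - x2 K) * geom2 K) * ((w - x2 K) * W)
  + geom2 K * ((1 - x1 K) * geom1 K) * ((x1 K - w) * W))); first by ring.
by rewrite geom1_inv geom2_inv !mulr1.
Qed.

Lemma reduced_alternant1E a b k : (a + b + k.+1 = n)%N ->
  reduced_alternant R (1 : {perm T}) a.+1 b =
  ((trinom a b)%:R - (if b is b'.+1 then (trinom a.+1 b')%:R else 0)) * ('X - 1) ^+ k
  + (\sum_(i < a.+2) ('X * ((trinom i b)%:R * ('X - 1) ^+ (n - i - b))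
       - (if b is b'.+1 then (trinom i b')%:R * ('X - 1) ^+ (n - i - b') else 0))
  + \sum_(j < b.+1) ((trinom a j)%:R * ('X - 1) ^+ (n - a - j)
       - 'X * ((trinom a.+1 j)%:R * ('X - 1) ^+ (n - a.+1 - j)))).
Proof.
move=> abk; have X1 : ('X - 1 : K) != 0 by rewrite -polyC1 polyXsubC_eq0.
apply: (mulfI X1); rewrite -reduced_alternantE; last by lia.
rewrite alternant_partial_fractions pser2DE mulrBl pser2BE x1ME x2ME.
have -> : xw R - 1 = pserCC ('X - 1) by rewrite rmorphB rmorph1.
rewrite pserCCME pser2DE geom1ME geom2ME [RHS]mulrDr; congr (_ + _ * (_ + _)).
- rewrite !cycle_series1E (_ : n - a - b = k.+1)%N; last by lia.
  case: b abk => [|b] abk; first by rewrite !subr0 exprS; ring.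
  rewrite cycle_series1E (_ : n - a.+1 - b = k.+1)%N; last by lia.
  by rewrite exprS; ring.
- apply: eq_bigr => i _; rewrite mulrBl pser2BE pserCCME x2ME cycle_series1E.
  by case: b abk => // b _; rewrite cycle_series1E.
- apply: eq_bigr => j _; rewrite mulrBl pser2BE pserCCME x1ME cycle_series1E.
  by rewrite cycle_series1E.
Qed.

(** At [w = 1/y] one has [w - 1 = (1 - y) / y], which turns the powers of [w - 1] into binomial
    probabilities up to a common power of [y]. *)
Lemma sum_trinom b m (y : R) : 0 < y -> (m <= n - b)%N ->
  \sum_(i < m.+1) (trinom i b)%:R * (y^-1 - 1) ^+ (n - i - b) =
  'C(n, b)%:R * binom_tail (n - b) m y / y ^+ (n - b).
Proof.
move=> y0 mn; rewrite /binom_tail mulr_sumr mulr_suml; apply: eq_bigr => i _.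
have im : (i <= m)%N := leq_ord i.
rewrite trinomC /trinom natrM (_ : n - i - b = n - b - i)%N; last by lia.
have yn0 : y != 0 by rewrite gt_eqF.
have -> : y^-1 - 1 = (1 - y) / y by field.
have -> : y ^+ (n - b) = y ^+ i * y ^+ (n - b - i) by rewrite -exprD subnKC //
    (leq_trans im).
rewrite expr_div_n; field.
by rewrite !expf_neq0.
Qed.

End InitialValue.

Section PsiFormula.
Variables (R : realType) (T : finType).
Local Notation n := #|T|.
Local Notation initial_alternant := (reduced_alternant R (1 : {perm T})).

Lemma bin_factR N m : (m <= N)%N ->
  'C(N, m)%:R = N`!%:R / (m`!%:R * (N - m)`!%:R) :> R.
Proof.
move=> mN; by rewrite -(bin_fact mN) !natrM mulfK.
Qed.

Lemma horner_pow_XB1 (v : R) m : (('X - 1 : {poly R}) ^+ m).[v] = (v - 1) ^+ m.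
Proof. by rewrite horner_exp hornerD hornerN hornerX -polyC1 hornerC. Qed.

Lemma sum_trinom_r a m (y : R) : 0 < y -> (m <= n - a)%N ->
  \sum_(j < m.+1) (trinom T a j)%:R * (y^-1 - 1) ^+ (n - a - j) =
  'C(n, a)%:R * binom_tail (n - a) m y / y ^+ (n - a).
Proof.
move=> y0 mn; rewrite -sum_trinom //; apply: eq_bigr => j _.
by rewrite trinomC; congr (_ * _ ^+ _); rewrite -!subnDA addnC.
Qed.

Lemma initial_alternant_succ a b k (y : R) : (a + b.+1 + k.+1 = n)%N -> 0 < y -> y
    <= 1 ->
  let c : R := a%:R + 1 - b.+1%:R in
  y ^+ n.+1 * (initial_alternant a.+1 b.+1).[y^-1] =
  multinomial3 R n k a.+1 b.+1 *
    (c * y ^+ (a + b.+1 + 2)%N * (1 - y) ^+ k / k.+1%:R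
     + y ^+ b.+1 * (c + k.+1%:R) * inc_beta y a.+1 k
     + y ^+ a.+1 * (c - k.+1%:R) * inc_beta y b.+1 k).
Proof.
move=> abk y0 y1 c; rewrite (reduced_alternant1E _ abk).
rewrite !(hornerD, hornerM, hornerN, horner_sum, horner_pow_XB1).
under eq_bigr do rewrite !(hornerD, hornerM, hornerN, hornerX, horner_pow_XB1)
    -!polyC_natr !hornerC.
under [X in _ + (_ + X)]eq_bigr do rewrite !(hornerD, hornerM, hornerN, hornerX,
    horner_pow_XB1) -!polyC_natr !hornerC.
rewrite -!polyC_natr !hornerC !big_split /= !sumrN -!mulr_sumr.
rewrite !sum_trinom_r ?sum_trinom //; try lia.
rewrite /trinom.
rewrite (_ : n - b.+1 = (a + k).+1)%N; last by lia.
rewrite (_ : n - b = (a + k).+2)%N; last by lia.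
rewrite (_ : n - a.+1 = (b + k).+1)%N; last by lia.
rewrite (_ : n - a = (b + k).+2)%N; last by lia.
have y0' : y != 0 by rewrite gt_eqF.
have e1 : binom_tail (a + k).+2 a.+1 y =
   k.+1%:R * 'C((a + k).+2, a.+1)%:R * inc_beta y a.+1 k.
  by rewrite binom_tail_beta //; [congr (_%:R * _ * inc_beta _ _ _) | ]; lia.
(* One more trial brings every tail to the exponent [k] of [1 - x], so that just two beta integrals
   remain. *)
have e2 : binom_tail (a + k).+1 a.+1 y = binom_tail (a + k).+2 a.+1 y +
    'C((a + k).+1, a.+1)%:R * (y ^+ a.+2 * (1 - y) ^+ k).
  by rewrite binom_tailS; [congr (_ + _ * (_ * _ ^+ _)) | ]; lia.
have e3 : binom_tail (b + k).+2 b.+1 y =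
   k.+1%:R * 'C((b + k).+2, b.+1)%:R * inc_beta y b.+1 k.
  by rewrite binom_tail_beta //; [congr (_%:R * _ * inc_beta _ _ _) | ]; lia.
have e4 : binom_tail (b + k).+1 b.+1 y = binom_tail (b + k).+2 b.+1 y +
    'C((b + k).+1, b.+1)%:R * (y ^+ b.+2 * (1 - y) ^+ k).
  by rewrite binom_tailS; [congr (_ + _ * (_ * _ ^+ _)) | ]; lia.
rewrite e2 e4 e1 e3 !natrM !bin_factR; try lia.
rewrite (_ : n - b.+1 = (a + k).+1)%N; last by lia.
rewrite (_ : n - b = (a + k).+2)%N; last by lia.
rewrite (_ : n - a.+1 = (b + k).+1)%N; last by lia.
rewrite (_ : n - a = (b + k).+2)%N; last by lia.
rewrite (_ : (a + k).+2 - a.+1 = k.+1)%N; last by lia.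
rewrite (_ : (a + k).+1 - a.+1 = k)%N; last by lia.
rewrite (_ : (b + k).+2 - b.+1 = k.+1)%N; last by lia.
rewrite (_ : (b + k).+1 - b = k.+1)%N; last by lia.
rewrite (_ : (b + k).+1 - b.+1 = k)%N; last by lia.
rewrite /multinomial3 /c.
have -> : y^-1 - 1 = (1 - y) / y by field.
rewrite -abk expr_div_n.
set ib := inc_beta y b.+1 k; set ia := inc_beta y a.+1 k.
set z := (1 - y) ^+ k.
have f0 m : (m`!%:R : R) != 0 by rewrite pnatr_eq0 -lt0n fact_gt0.
have ya := expf_neq0 a y0'; have yb := expf_neq0 b y0'; have yk := expf_neq0 k y0'.
have fa := f0 a; have fb := f0 b; have fk := f0 k.
have fak := f0 (a + k)%N; have fbk := f0 (b + k)%N.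
set F := (a + b.+1 + k.+1)`!%:R.
rewrite !factS !addnS !addSn !addn0 !exprS !exprD !natrM.
move: ya yb yk fa fb fk fak fbk; rewrite -/z.
move: (y ^+ a) (y ^+ b) (y ^+ k) z (a`!%:R : R) (b`!%:R : R) (k`!%:R : R)
  ((a + k)`!%:R : R) ((b + k)`!%:R : R) F ia ib => ya yb yk z' fa fb fk fak fbk F'
      ia' ib'.
move=> ? ? ? ? ? ? ? ?.
field.
by rewrite -!natrD !nat1r !pnatr_eq0; do ?[apply/andP; split].
Qed.

(** For [b = 0] the partial sum over [j] has a single term, so there is only one beta integral;
    lowering its tail by one step gives the exponent [a]. *)
Lemma initial_alternant_zero a k (y : R) : (a + k.+1 = n)%N -> 0 < y -> y <= 1 ->
  y ^+ n.+1 * (initial_alternant a.+1 0%N).[y^-1] =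
  'C(n, k.+1)%:R * (y ^+ a.+1 * (1 - y) ^+ k + k.+1%:R * inc_beta y a k).
Proof.
move=> ak y0 y1; rewrite (@reduced_alternant1E _ _ a 0%N k) ?addn0 // subr0.
rewrite !(hornerD, hornerM, hornerN, horner_sum, horner_pow_XB1) big_ord1.
under eq_bigr do rewrite subr0 !(hornerM, hornerX, horner_pow_XB1) -!polyC_natr
    !hornerC.
rewrite !(hornerD, hornerM, hornerN, hornerX, horner_pow_XB1) -!polyC_natr !hornerC.
rewrite -!mulr_sumr sum_trinom //; last by lia.
have y0' : y != 0 by rewrite gt_eqF.
rewrite binom_tail_recr binom_tail_beta //; try lia.
rewrite /trinom !bin0 !subn0 !muln1.
rewrite (_ : n - a = k.+1)%N; last by lia.
rewrite (_ : n - a.+1 = k)%N; last by lia.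
rewrite (_ : 'C(n, k.+1) = 'C(n, a))%N; last first.
  by rewrite -[in RHS](@bin_sub n a) -?ak ?addKn // leq_addr.
have -> : y^-1 - 1 = (1 - y) / y by field.
rewrite -ak !expr_div_n.
set ia := inc_beta y a k; set z := (1 - y) ^+ k.
move: ('C(_, a)%:R : R) ('C(_, a.+1)%:R : R) => ca ca1.
have ya := expf_neq0 a y0'; have yk := expf_neq0 k y0'.
rewrite !addnS !exprS !exprD -/z; move: ya yk; move: (y ^+ a) (y ^+ k) z ia => ya
    yk z' ia'.
move=> ? ?.
field.
by apply/and3P.
Qed.

Lemma psi_reduced_alternant a b k t : (a + b + k.+1 = n)%N -> 0 <= t ->
  let y : R := expR (- (t * k.+1%:R)) in
  psi n b k.+1 t = (a%:R + 1 - b%:R) * expR (- (t * (a * b + b)%N%:R)) *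
    (y ^+ n.+1 * (initial_alternant a.+1 b).[y^-1]).
Proof.
move=> abk t0 y.
have y0 : 0 < y by exact: expR_gt0.
have y1 : y <= 1 by rewrite expR_le1 oppr_le0 mulr_ge0.
rewrite /psi (_ : n - k.+1 - b = a)%N; last by lia.
rewrite -/y /=; case: b abk => [|b] abk /=.
  rewrite (@initial_alternant_zero a k) //; last by lia.
  rewrite muln0 addn0 mulr0n mulr0 oppr0 expR0 mulr1 addr0 (_ : n - k.+1 = a)%N;
      last by lia.
  by rewrite addn1 mulrA.
by rewrite (@initial_alternant_succ a b k) // [RHS]mulrA; congr (_ * _);
    rewrite [RHS]mulrAC.
Qed.

End PsiFormula.

(** * The law of the interchange process *)

Section ClockPaths.
Local Open Scope classical_set_scope.
Local Open Scope ring_scope.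
Variable R : realType.

(** The jump happens at the supremum of the times at which [N] keeps its value at [s]: by right
    continuity, this value at the supremum itself would persist beyond it. *)
Lemma jump_time (N : R -> nat) (s s' : R) : 0 <= s -> s <= s' ->
  (forall r r', 0 <= r -> r <= r' -> (N r <= N r')%N) ->
  (forall t, 0 <= t -> \forall u \near t^'+, N u = N t) ->
  N s' = (N s).+1 ->
  exists u, [/\ s < u, u <= s', N u = (N s).+1 &
    forall r, s <= r -> r < u -> N r = N s].
Proof.
move=> s0 ss' mono rc jump.
pose S := [set r | [/\ s <= r, r <= s' & N r = N s]]%classic.
have Ss : S s by [].
have ubS : ubound S s' by move=> r [].
have hS : has_sup S by split; [exists s | exists s'].
pose u := sup S.
have su : s <= u by apply: ub_le_sup; [exists s' | ].
have us' : u <= s' by apply: ge_sup; [exists s | ].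
have u0 : 0 <= u := le_trans s0 su.
have before r : s <= r -> r < u -> N r = N s.
  move=> sr ru; have [e [se es' Ne] ue] : exists2 e, S e & u - (u - r) < e.
    by apply: sup_adherent => //; rewrite subr_gt0.
  rewrite subKr in ue.
  have h1 := mono _ _ (le_trans s0 sr) (ltW ue); have h2 := mono _ _ s0 sr.
  by apply/eqP; rewrite eqn_leq h2 andbT -Ne h1.
have Nu : N u != N s.
  apply/eqP => Nu; have us : u < s'.
    by rewrite lt_neqAle us' andbT; apply/eqP => us; move: Nu; rewrite us jump; lia.
  have [r [[ur rs] Nr]] := @filter_ex _ _ _ _
    (filterI (filterI (nbhs_right_gt u) (nbhs_right_lt us)) (rc _ u0)).
  have : r <= u.
    by apply: ub_le_sup; [exists s' | split; rewrite ?Nr ?(ltW rs) // (le_trans su)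
        // ltW].
  by rewrite leNgt ur.
have su' : s < u by rewrite lt_neqAle su andbT; apply: contraNneq Nu => <-.
exists u; split => //.
have := mono _ _ u0 us'; have := mono _ _ s0 su; rewrite jump.
by move: Nu => /eqP; lia.
Qed.

Variables (d : measure_display) (T : measurableType d) (P : probability T R).
Variables (n : nat) (N : edge n -> R -> T -> nat) (pi : R -> T -> 'S_n).
Hypothesis driven : driven_by_clocks P N pi.

Let mono e w s t : 0 <= s -> s <= t -> (N e s w <= N e t w)%N.
Proof. exact/poisson_mono/(clocks_poisson driven). Qed.

Lemma no_ring e w s t u : 0 <= s -> N e t w = N e s w ->
  s < u -> u <= t -> ~ rings (N e) u w.
Proof.
move=> s0 Nst su ut [u0 /(_ s s0 su)]; rewrite -Nst ltnNge => /negP; apply.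
by rewrite mono // ltW.
Qed.

Lemma interchange_no_jump w s t : 0 <= s -> s <= t ->
  (forall e, N e t w = N e s w) -> pi t w = pi s w.
Proof.
move=> s0 st Nst; apply: (pi_constant driven) => // e u su ut.
exact: (no_ring s0 (Nst e)).
Qed.

(** The only ring splits the interval into two silent stretches, on which [pi] is constant;
    [pi_jump] links them through a time just before the ring. *)
Lemma interchange_one_jump w s t e : 0 <= s -> s <= t ->
  N e t w = (N e s w).+1 -> (forall f, f != e -> N f t w = N f s w) ->
  pi t w = (pi s w * transposition e)%g.
Proof.
move=> s0 st Ne Nf.
have [u [su ut Nu before]] : exists u, [/\ s < u, u <= t, N e u w = (N e s w).+1 &
    forall r, s <= r -> r < u -> N e r w = N e s w].
  apply: (jump_time (N := fun r => N e r w)) => // [r r'|r]; first exact: mono.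
  exact: (poisson_rcont (clocks_poisson driven e)).
have u0 : 0 < u := le_lt_trans s0 su.
have other f r r' : f != e -> s <= r -> r <= r' -> r' <= t -> N f r' w = N f r w.
  move=> fe sr rr' r't; have r0 := le_trans s0 sr.
  have := mono f w r0 rr'; have := mono f w (le_trans r0 rr') r't.
  by have := mono f w s0 sr; have := Nf f fe; lia.
have ring_e : rings (N e) u w.
  split=> // r r0 ru; rewrite Nu ltnS; have [sr|rs] := leP s r.
    by rewrite before.
  exact/mono/ltW.
have jump := pi_jump driven ring_e.
have {}jump : \forall r \near u^'-, pi u w = (pi r w * transposition e)%g.
  apply: jump => f fe; apply: (no_ring s0 (t := u)) => //.
  by apply: other => //; exact: ltW.
have [r [[sr ru] Er]] := @filter_ex _ _ _ _
  (filterI (filterI (nbhs_left_gt su) (nbhs_left_lt u)) jump).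
have -> : pi t w = pi u w.
  apply: interchange_no_jump => [||f]; rewrite ?(ltW u0) //.
  have [->|fe] := eqVneq f e; first by rewrite Ne Nu.
  by apply: other => //; exact: ltW.
rewrite Er; congr (_ * _)%g; apply: interchange_no_jump => [||f] //; first exact: ltW.
have [->|fe] := eqVneq f e; first by rewrite before // ltW.
by apply: other => //; [exact: ltW | exact: ltW (lt_le_trans ru ut)].
Qed.

End ClockPaths.

Section GridIncrements.
Local Open Scope classical_set_scope.
Local Open Scope ring_scope.
Variable R : realType.

(** Kept free of the probability space, because it serves both the ambient sigma-algebra and the one
    generated by a single clock. *)
Lemma measurable_nat_preimages d (T : measurableType d) (f g : T -> nat) k :
  (forall B, measurable (f @^-1` B)) -> (forall B, measurable (g @^-1` B)) ->
  measurable [set w | (g w - f w)%N = k].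
Proof.
move=> mf mg.
have -> : [set w | (g w - f w)%N = k] =
    \bigcup_j (f @^-1` [set j] `&` g @^-1` [set x | (x - j)%N = k]).
  apply/seteqP; split=> w /= => [<-|[j _ [/= <- //]]].
  by exists (f w).
by apply: bigcupT_measurable => j; apply: measurableI.
Qed.

Variables (d : measure_display) (T : measurableType d) (P : probability T R).

Lemma process_sigma_preimage (N : R -> T -> nat) t (B : set nat) : 0 <= t ->
  process_sigma N (N t @^-1` B).
Proof.
move=> t0; apply: sub_sigma_algebra; exists t => //.
by exists B => //; rewrite setTI.
Qed.

Lemma process_sigma_increments (N : R -> T -> nat) m (tau : nat -> R) (k : 'I_m ->
    nat) :
  (forall i, (i <= m)%N -> 0 <= tau i) ->
  process_sigma N [set w | forall i : 'I_m, (N (tau i.+1) w - N (tau i) w)%N = k i].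
Proof.
move=> tau0; rewrite /process_sigma; set G := \bigcup_(t in [set t : R | 0 <= t]) _.
change (measurable ([set w | forall i : 'I_m, (N (tau i.+1) w - N (tau i) w)%N = k i]
  : set (g_sigma_algebraType G))).
have -> : [set w | forall i : 'I_m, (N (tau i.+1) w - N (tau i) w)%N = k i] =
    \bigcap_(i in [set: 'I_m]) [set w | (N (tau i.+1) w - N (tau i) w)%N = k i].
  by apply/seteqP; split=> w /= h; [move=> i _ | move=> i]; apply: h.
apply: fin_bigcap_measurable => // i _.
apply: (@measurable_nat_preimages _ (g_sigma_algebraType G)) => B;
  apply: process_sigma_preimage; apply: tau0 => //; exact: ltnW.
Qed.

Lemma poisson_grid (rate : R) (N : R -> T -> nat) m (tau : nat -> R) (k : 'I_m -> nat) :
  poisson_process P rate N -> 0 <= tau 0%N ->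
  (forall i, (i < m)%N -> tau i < tau i.+1) ->
  P [set w | forall i : 'I_m, (N (tau i.+1) w - N (tau i) w)%N = k i] =
  (\prod_(i < m) poisson_pmf (rate * (tau i.+1 - tau i)) (k i))%:E.
Proof.
move=> poisN tau0 incr.
have tau_ge0 i : (i <= m)%N -> 0 <= tau i.
  elim: i => // i ih im; apply: le_trans (ih (ltnW im)) _; exact/ltW/incr.
have inG (i : 'I_m) : preimage_set_system setT
    (fun w => (N (tau i.+1) w - N (tau i) w)%N) measurable
    [set w | (N (tau i.+1) w - N (tau i) w)%N = k i].
  by exists [set k i] => //; rewrite setTI.
have := poisson_indep_increments poisN tau0 (fun i im => ltW (incr i im))
  (J := [set: 'I_m]%SET) (fun i _ => inG i).
have -> : [set w | forall i : 'I_m, i \in [set: 'I_m]%SET ->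
      [set w | (N (tau i.+1) w - N (tau i) w)%N = k i] w] =
    [set w | forall i : 'I_m, (N (tau i.+1) w - N (tau i) w)%N = k i].
  by apply/seteqP; split=> w /= h i => [|_]; apply: h; rewrite ?inE.
move=> ->; rewrite -prodEFin; apply: eq_big => [i|i _]; first by rewrite inE.
by rewrite (poisson_increment_law poisN) ?tau_ge0 ?incr // ltnW.
Qed.

Lemma clocks_grid (n : nat) (N : edge n -> R -> T -> nat) m (tau : nat -> R)
    (k : edge n -> 'I_m -> nat) :
  (forall e, poisson_process P 1 (N e)) ->
  mutually_independent P (fun e => process_sigma (N e)) ->
  0 <= tau 0%N -> (forall i, (i < m)%N -> tau i < tau i.+1) ->
  P [set w | forall e (i : 'I_m), (N e (tau i.+1) w - N e (tau i) w)%N = k e i] =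
  (\prod_e \prod_(i < m) poisson_pmf (tau i.+1 - tau i) (k e i))%:E.
Proof.
move=> pois indep tau0 incr.
have tau_ge0 i : (i <= m)%N -> 0 <= tau i.
  elim: i => // i ih im; apply: le_trans (ih (ltnW im)) _; exact/ltW/incr.
have := indep [set: edge n]%SET
  (fun e => [set w | forall i : 'I_m, (N e (tau i.+1) w - N e (tau i) w)%N = k e i]).
move=> /(_ (fun e _ => process_sigma_increments _ tau_ge0)).
have -> : [set w | forall e, e \in [set: edge n]%SET ->
      [set w | forall i : 'I_m, (N e (tau i.+1) w - N e (tau i) w)%N = k e i] w] =
    [set w | forall e (i : 'I_m), (N e (tau i.+1) w - N e (tau i) w)%N = k e i].
  by apply/seteqP; split=> w /= h e => [|_]; apply: h; rewrite ?inE.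
move=> ->; rewrite -prodEFin; apply: eq_big => [e|e _]; first by rewrite inE.
rewrite (poisson_grid _ (pois e)) //; congr (_%:E).
by apply: eq_bigr => i _; rewrite mul1r.
Qed.

Lemma measurable_grid (n : nat) (N : edge n -> R -> T -> nat) m (tau : nat -> R)
    (k : edge n -> 'I_m -> nat) :
  (forall e, poisson_process P 1 (N e)) -> (forall i, (i <= m)%N -> 0 <= tau i) ->
  measurable [set w | forall e (i : 'I_m), (N e (tau i.+1) w - N e (tau i) w)%N = k
      e i].
Proof.
move=> pois tau0.
have -> : [set w | forall e (i : 'I_m), (N e (tau i.+1) w - N e (tau i) w)%N = k e i] =
    \bigcap_(e in [set: edge n]) \bigcap_(i in [set: 'I_m])
      [set w | (N e (tau i.+1) w - N e (tau i) w)%N = k e i].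
  by apply/seteqP; split=> w /= h; [move=> e _ i _ | move=> e i]; apply: h.
apply: fin_bigcap_measurable => // e _; apply: fin_bigcap_measurable => // i _.
apply: measurable_nat_preimages => B; rewrite -[X in measurable X]setTI;
  apply: (poisson_measurable (pois e)) => //; apply: tau0 => //; exact: ltnW.
Qed.

End GridIncrements.

(** * Eigenfunctions under the discrete walk, and the exponential limit *)

Section DiscreteWalk.
Variables (R : realType) (n : nat).
Local Notation jump := (option (edge n)).

Definition jump_perm (o : jump) : 'S_n := if o is Some e then transposition e else 1%g.

Lemma sum_ffun_recr (V : nmodType) (O : finType) m (F : {ffun 'I_m.+1 -> O} -> V) :
  \sum_f F f = \sum_(g : {ffun 'I_m -> O}) \sum_(o : O)
    F [ffun i => if unlift ord_max i is Some j then g j else o].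
Proof.
rewrite pair_big /=.
rewrite (reindex (fun p : {ffun 'I_m -> O} * O =>
  [ffun i => if unlift ord_max i is Some j then p.1 j else p.2] : {ffun 'I_m.+1 ->
      O})) //.
exists (fun f : {ffun 'I_m.+1 -> O} =>
  ([ffun j : 'I_m => f (lift ord_max j)], f ord_max)) => [[g o]|f] _ /=.
  congr (_, _); last by rewrite ffunE unlift_none.
  by apply/ffunP => j; rewrite !ffunE liftK.
by apply/ffunP => i; rewrite ffunE; case: unliftP => [j ->|->]; rewrite ?ffunE.
Qed.

(** The last jump is the rightmost factor; summing over it first multiplies [f] by
    [q0 + q1 * lam]. *)
Lemma walk_eigenfunction (f : 'S_n -> R) lam q0 q1 m s :
  (forall s, \sum_e f (s * transposition e)%g = lam * f s) ->
  \sum_(eps : {ffun 'I_m -> jump})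
    (\prod_(i < m) (if eps i is Some _ then q1 else q0)) *
    f (s * \prod_(i < m) jump_perm (eps i))%g =
  (q0 + q1 * lam) ^+ m * f s.
Proof.
move=> eig; elim: m s => [|m ih] s.
  rewrite expr0 mul1r (big_pred1 [ffun i : 'I_0 => None]) => [|g /=].
    by rewrite !big_ord0 mul1r mulg1.
  by apply/esym/eqP/ffunP => -[].
rewrite sum_ffun_recr.
transitivity (\sum_(g : {ffun 'I_m -> jump})
    (\prod_(i < m) (if g i is Some _ then q1 else q0)) *
    ((q0 + q1 * lam) * f (s * \prod_(i < m) jump_perm (g i))%g)).
  apply: eq_bigr => g _; set w := \prod_(i < m) _; set p := (\prod_(i < m) _)%g.
  have E (o : jump) (i : 'I_m) :
      [ffun i => if unlift ord_max i is Some j then g j else o] (widen_ord (leqnSn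
          m) i) = g i.
    rewrite ffunE; have -> : widen_ord (leqnSn m) i = lift ord_max i.
      by apply: val_inj; rewrite /= /bump leqNgt ltn_ord.
    by rewrite liftK.
  have Em (o : jump) : [ffun i => if unlift ord_max i is Some j then g j else o]
      ord_max = o.
    by rewrite ffunE unlift_none.
  have term (o : jump) : (\prod_(i < m.+1) (if [ffun i => if unlift ord_max i is Some j
         then g j else o] i is Some _ then q1 else q0)) *
      f (s * \prod_(i < m.+1) jump_perm ([ffun i => if unlift ord_max i is Some j
         then g j else o] i))%g =
      w * (if o is Some _ then q1 else q0) * f (s * p * jump_perm o)%g.
    rewrite !big_ord_recr /= Em mulgA; congr (_ * _ * f (_ * _ * _)%g).
      by apply: eq_bigr => i _; rewrite E.
    by apply: eq_bigr => i _; rewrite E.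
  rewrite (eq_bigr _ (fun o _ => term o)) (bigD1 None) //= mulg1.
  rewrite (reindex_omap (@Some (edge n)) id) => [|[e|]//].
  under eq_bigr => e _ do rewrite -mulrA.
  rewrite -mulr_sumr -mulr_sumr (eq_bigl xpredT) => [|e]; last by rewrite /= eqxx.
  by rewrite eig; ring.
rewrite exprS -mulrA -ih mulr_sumr; apply: eq_bigr => g _.
by rewrite mulrCA.
Qed.

End DiscreteWalk.

Section ExponentialLimit.
Variable R : realType.
Local Open Scope classical_set_scope.
Local Open Scope ring_scope.

Lemma bernoulli_ineq (x : R) m : -1 <= x -> 1 + m%:R * x <= (1 + x) ^+ m.
Proof.
move=> x1; elim: m => [|m ih]; first by rewrite mul0r addr0 expr0.
rewrite exprS; apply: le_trans (_ : (1 + x) * (1 + m%:R * x) <= _).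
  rewrite -natr1 -subr_ge0.
  have -> : (1 + x) * (1 + m%:R * x) - (1 + (m%:R + 1) * x) = m%:R * (x * x) by ring.
  by rewrite mulr_ge0 // -expr2 sqr_ge0.
by rewrite ler_wpM2l //; lra.
Qed.

(** With [u = x / m.+1], the upper bound is [1 + u <= exp u]. The lower one multiplies
    [1 - u <= exp (- u)] by [1 + u] and applies the Bernoulli inequality to [(1 - u^2)^(m+1)]. *)
Lemma cvg_expR_pow (x : R) :
  ((1 + x / m.+1%:R) ^+ m.+1) @[m --> \oo] --> expR x.
Proof.
have lowcvg : (expR x * (1 - x ^+ 2 / m.+1%:R)) @[m --> \oo] --> expR x.
  rewrite -[X in _ --> X]mulr1 -[X in _ * X](subr0 1) -[X in _ - X](mulr0 (x ^+ 2)).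
  apply: cvgMr; apply: cvgB; first exact: cvg_cst.
  by apply: cvgMr; exact: cvg_harmonic.
apply: squeeze_cvgr lowcvg (cvg_cst (expR x)).
near=> m.
have xm : `|x| <= m.+1%:R.
  apply: le_trans (_ : m%:R <= _); last by rewrite ler_nat.
  by near: m; exact: nbhs_infty_ger.
have m0 : 0 < m.+1%:R :> R by [].
set u := x / m.+1%:R.
have u1 : `|u| <= 1 by rewrite normrM normfV (gtr0_norm m0) ler_pdivrMr // mul1r.
have [u1' u1''] : -1 <= u /\ u <= 1 by apply/andP; rewrite -ler_norml.
have ex : expR x = expR u ^+ m.+1 by rewrite -expRM_natr mulrVK // unitfE gt_eqF.
apply/andP; split; last first.
  by rewrite ex lerXn2r ?nnegrE ?expR_ge0 ?expR_ge1Dx //; lra.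
have e1 : 1 - u ^+ 2 <= (1 + u) * expR (- u).
  have -> : 1 - u ^+ 2 = (1 + u) * (1 + - u) by ring.
  by rewrite ler_wpM2l ?expR_ge1Dx //; lra.
have : (1 - u ^+ 2) ^+ m.+1 <= ((1 + u) * expR (- u)) ^+ m.+1.
  have u2 : u ^+ 2 <= 1 by rewrite -[u ^+ 2]real_normK ?num_real // expr_le1.
  by rewrite lerXn2r ?nnegrE ?mulr_ge0 ?expR_ge0 //; lra.
have b : 1 + m.+1%:R * (- u ^+ 2) <= (1 - u ^+ 2) ^+ m.+1.
  apply: bernoulli_ineq; have : u ^+ 2 <= 1 by rewrite -[u ^+ 2]real_normK
      ?num_real // expr_le1.
  by lra.
move=> h; have {b h} := le_trans b h.
rewrite [X in _ <= X -> _]exprMn expRN exprVn -ex ler_pdivlMr ?expR_gt0 // mulrC.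
have -> : 1 + m.+1%:R * - u ^+ 2 = 1 - x ^+ 2 / m.+1%:R.
  by rewrite /u; field; rewrite gt_eqF.
done.
Unshelve. all: end_near. Qed.

End ExponentialLimit.

Section InterchangeLaw.
Local Open Scope classical_set_scope.
Local Open Scope ring_scope.
Variables (R : realType) (d : measure_display) (T : measurableType d).
Variables (P : probability T R) (n : nat).
Variables (N : edge n -> R -> T -> nat) (pi : R -> T -> 'S_n).
Hypothesis driven : driven_by_clocks P N pi.
Local Notation jump := (option (edge n)).
Local Notation E := #|{: edge n}|.

Section Grid.
Variables (h : R) (m : nat).
Hypothesis h0 : 0 < h.
Let tau (i : nat) : R := i%:R * h.

Let tau0 i : 0 <= tau i. Proof. by rewrite mulr_ge0 // ltW. Qed.
Let tau_lt i : tau i < tau i.+1. Proof. by rewrite ltr_pM2r // ltr_nat. Qed.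

(** The Boolean is read as a number of rings: in step [i] the clock [eps i] rings exactly once and
    the others are silent, all of them if [eps i] is [None]. *)
Definition grid_event (eps : {ffun 'I_m -> jump}) : set T :=
  [set w | forall e (i : 'I_m),
     (N e (tau i.+1) w - N e (tau i) w)%N = (eps i == Some e)].

Lemma grid_event_perm eps w : grid_event eps w ->
  pi (tau m) w = (\prod_(i < m) jump_perm (eps i))%g.
Proof.
move=> Gw; pose f i := if insub i is Some j then jump_perm (eps j) else 1%g.
have fE (i : 'I_m) : f i = jump_perm (eps i) by rewrite /f valK.
transitivity (\prod_(0 <= i < m) f i)%g; last first.
  by rewrite big_mkord; apply: eq_bigr => i _; rewrite fE.
suff H i : (i <= m)%N -> pi (tau i) w = (\prod_(0 <= j < i) f j)%g by exact: H.
elim: i => [|i ih] im.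
  by rewrite big_geq // /tau mul0r (pi_start driven).
rewrite big_nat_recr //= -ih; last exact: ltnW.
rewrite (fE (Ordinal im)).
have incr e : N e (tau i.+1) w = (N e (tau i) w + (eps (Ordinal im) == Some e))%N.
  have mono : (N e (tau i) w <= N e (tau i.+1) w)%N.
    exact/(poisson_mono (clocks_poisson driven e))/ltW.
  by rewrite -(Gw e (Ordinal im)) subnKC.
case Eo : (eps (Ordinal im)) incr => [e|] incr /=.
  apply: (interchange_one_jump driven) => //; first exact: ltW.
    by rewrite incr eqxx addn1.
  move=> f' fe; rewrite incr (_ : Some e == Some f' = false) ?addn0 //.
  by apply/eqP => -[ef]; rewrite ef eqxx in fe.
rewrite mulg1; apply: (interchange_no_jump driven) => // [|e]; first exact: ltW.
by rewrite incr addn0.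
Qed.

Lemma grid_event_measurable eps : measurable (grid_event eps).
Proof.
exact: (measurable_grid _ (clocks_poisson driven)).
Qed.

(** In each step every clock contributes [expR (- h)], whether it rings once or not, and a ring
    contributes a further [h]. *)
Lemma grid_event_prob eps : P (grid_event eps) =
  (\prod_(i < m) (if eps i is Some _ then h * expR (- h) ^+ E else expR (- h) ^+ E))%:E.
Proof.
rewrite (clocks_grid _ (clocks_poisson driven) (clocks_indep driven)) //.
rewrite exchange_big /=; congr (_%:E); apply: eq_bigr => i _.
have -> : tau i.+1 - tau i = h by rewrite /tau -natr1; ring.
have pmfE e : poisson_pmf h (eps i == Some e) =
    expR (- h) * (if eps i == Some e then h else 1).
  rewrite /poisson_pmf h0; case: eqP => _ /=.
    by rewrite expr1 (_ : 1`! = 1)%N // invr1 mulr1 mulrC.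
  by rewrite expr0 fact0 invr1 !mul1r mulr1.
rewrite (eq_bigr _ (fun e _ => pmfE e)) big_split /= prodr_const mulrC.
case: (eps i) => [e0|]; last by rewrite big1 ?mul1r.
congr (_ * _); rewrite (bigD1 e0) //= eqxx big1 ?mulr1 // => e ee0.
by case: eqP => // -[e0e]; rewrite e0e eqxx in ee0.
Qed.

Lemma grid_event_disj eps eps' w : grid_event eps w -> grid_event eps' w -> eps = eps'.
Proof.
move=> G1 G2; apply/ffunP => i.
have key e : (eps i == Some e) = (eps' i == Some e).
  have := G1 e i; rewrite (G2 e i).
  by case: (_ == _); case: (_ == _).
case: (eps i) key => [e|] key.
  by have := key e; rewrite eqxx => /esym/eqP.
case: (eps' i) key => // e key; by have := key e; rewrite eqxx.
Qed.

(** Grid events are disjoint and determine the final permutation. Paths with several rings in one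
    step are lost, hence only an inequality. *)
Lemma grid_lower_bound (s : 'S_n) :
  \sum_(eps : {ffun 'I_m -> jump} | (\prod_(i < m) jump_perm (eps i))%g == s)
    \prod_(i < m) (if eps i is Some _ then h * expR (- h) ^+ E else expR (- h) ^+ E)
  <= fine (P [set w | pi (tau m) w = s]).
Proof.
have mpi : measurable [set w | pi (tau m) w = s] by exact: pi_measurable driven _ _ _.
rewrite -lee_fin fineK; last by rewrite fin_num_measure.
pose Q (eps : {ffun 'I_m -> jump}) := (\prod_(i < m) jump_perm (eps i))%g == s.
rewrite -sumEFin (eq_bigr _ (fun eps _ => esym (grid_event_prob eps))).
rewrite (@bigfs _ _ _ _ _ Q) ?index_enum_uniq // => [|eps _]; last first.
  by rewrite mem_index_enum.
rewrite -measure_fin_bigcup //; last 2 first.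
- by move=> eps eps' _ _ [w [G1 G2]]; exact: grid_event_disj G1 G2.
- by move=> eps _; exact: grid_event_measurable.
apply: le_measure; rewrite ?inE //.
  by apply: fin_bigcup_measurable => // eps _; exact: grid_event_measurable.
by move=> w [eps /eqP Qe Gw] /=; rewrite (grid_event_perm Gw).
Qed.

End Grid.

Lemma law_sum1 t : 0 <= t -> \sum_s fine (P [set w | pi t w = s]) = 1.
Proof.
move=> t0; have mpi s : measurable [set w | pi t w = s] by exact: pi_measurable
    driven _ _ _.
apply: EFin_inj; rewrite -sumEFin.
rewrite (eq_bigr (fun s => P [set w | pi t w = s])); last first.
  by move=> s _; rewrite fineK // fin_num_measure.
rewrite (@bigfs _ _ _ _ _ xpredT) ?index_enum_uniq // => [|s _]; last first.
  by rewrite mem_index_enum.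
rewrite -measure_fin_bigcup //; last by move=> s s' _ _ [w [<- <-]].
rewrite -(probability_setT P); congr (P _).
by apply/seteqP; split=> w // _; exists (pi t w).
Qed.

(** The factor that [m.+1] steps apply to an eigenfunction of eigenvalue [x]. For [x = E], the
    eigenvalue of constants, it is the total mass of the grid events. *)
Definition grid_weight (t : R) (m : nat) (x : R) : R :=
  expR (- (E%:R * t)) * (1 + x * t / m.+1%:R) ^+ m.+1.

(* [grid_lower_bound] controls the law from below only, but the masses missing
   on each side add up to [1 - grid_weight t m #|edges|], which tends to 0. *)
Lemma grid_eigenfunction_bound (f : 'S_n -> R) lam t m : 0 < t ->
  (forall s, \sum_e f (s * transposition e)%g = lam * f s) ->
  `|\sum_s f s * fine (P [set w | pi t w = s]) - grid_weight t m lam * f 1%g| <=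
  (\sum_s `|f s|) * (1 - grid_weight t m E%:R).
Proof.
move=> t0 eig; set a := grid_weight t m; set prob := fun s => fine (P [set w | pi t
    w = s]).
pose h := t / m.+1%:R.
have h0 : 0 < h by rewrite divr_gt0.
have th : m.+1%:R * h = t by rewrite mulrC divfK.
pose q0 := expR (- h) ^+ E; pose q1 := h * q0.
pose wt (eps : {ffun 'I_m.+1 -> jump}) := \prod_(i < m.+1) (if eps i is Some _ then
    q1 else q0).
pose word (eps : {ffun 'I_m.+1 -> jump}) := (\prod_(i < m.+1) jump_perm (eps i))%g.
pose c s := \sum_(eps | word eps == s) wt eps.
have cf (g : 'S_n -> R) : \sum_s g s * c s = \sum_eps wt eps * g (1 * word eps)%g.
  rewrite (partition_big word xpredT) //=; apply: eq_bigr => s _.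
  by rewrite mulr_sumr; apply: eq_bigr => eps /eqP ->; rewrite mul1g mulrC.
have aE x : (q0 + q1 * x) ^+ m.+1 = a x.
  have -> : q0 + q1 * x = q0 * (1 + x * t / m.+1%:R) by rewrite /q1 /h; ring.
  rewrite exprMn /a /grid_weight; congr (_ * _).
  rewrite /q0 -exprM -expRM_natl natrM -th; congr expR; ring.
have sumfc : \sum_s f s * c s = a lam * f 1%g.
  by rewrite cf (walk_eigenfunction _ _ _ _ eig) aE.
have sumc : \sum_s c s = a E%:R.
  under eq_bigr do rewrite -[c _]mul1r.
  have eig1 (s : 'S_n) : \sum_e (fun=> 1) (s * transposition e)%g = E%:R * (fun=>
      1) s :> R.
    by rewrite sumr_const mulr1.
  rewrite (cf (fun=> 1)); apply: etrans (walk_eigenfunction q0 q1 m.+1 1%g eig1) _.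
  by rewrite aE mulr1.
have cprob s : c s <= prob s.
  by have := grid_lower_bound m.+1 h0 s; rewrite th.
have sumprob := law_sum1 (ltW t0).
rewrite -sumfc -sumrB; apply: le_trans (ler_norm_sum _ _ _) _.
rewrite mulr_suml; apply: ler_sum => s _.
rewrite -mulrBr normrM ler_wpM2l //.
(* The deficits [prob s - c s] are nonnegative, so each is at most their sum. *)
rewrite ger0_norm ?subr_ge0 // -sumc -sumprob -sumrB (bigD1 s) //= lerDl.
by apply: sumr_ge0 => s' _; rewrite subr_ge0.
Qed.

Lemma interchange_eigenfunction (f : 'S_n -> R) lam t : 0 <= t ->
  (forall s, \sum_e f (s * transposition e)%g = lam * f s) ->
  \sum_s f s * fine (P [set w | pi t w = s]) = expR ((lam - E%:R) * t) * f 1%g.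
Proof.
(* At [t = 0] the grid would have mesh 0; there [pi_start] settles the claim. *)
rewrite le_eqVlt => /predU1P[<- _|t0 eig].
  rewrite mulr0 expR0 mul1r (bigD1 1%g) //= big1 => [|s s1].
    rewrite addr0 (_ : [set w | pi 0 w = 1%g] = setT) ?probability_setT ?mulr1 //.
    by apply/seteqP; split=> w // _; exact: (pi_start driven).
  rewrite (_ : [set w | pi 0 w = s] = set0) ?measure0 ?mulr0 //.
  by apply/seteqP; split=> w //=; rewrite (pi_start driven) => s1';
      rewrite s1' eqxx in s1.
set A := \sum_s _; set C := \sum_s `|f s|.
pose a x m := grid_weight t m x.
have acvg x : a x m @[m --> \oo] --> expR ((x - E%:R) * t).
  have -> : (x - E%:R) * t = - (E%:R * t) + x * t by ring.
  by rewrite expRD; apply: cvgMr; exact: cvg_expR_pow.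
have errcvg : (C * (1 - a E%:R m)) @[m --> \oo] --> (0 : R).
  have -> : 0 = C * (1 - expR ((E%:R - E%:R) * t)) by rewrite subrr mul0r expR0
      subrr mulr0.
  by apply: cvgMr; apply: cvgB; [exact: cvg_cst | exact: acvg].
have diffcvg : `|A - a lam m * f 1%g| @[m --> \oo] --> `|A - expR ((lam - E%:R) *
    t) * f 1%g|.
  by apply: cvg_norm; apply: cvgB; [exact: cvg_cst | apply: cvgMl; exact: acvg].
apply/eqP; rewrite -subr_eq0 -normr_le0.
apply: (ler_cvg_to diffcvg errcvg); apply: nearW => m.
exact: grid_eigenfunction_bound.
Qed.

End InterchangeLaw.

(** * Expectations, edges and cycle counts as finite sums *)

Section InterchangeExpectation.
Local Open Scope classical_set_scope.
Local Open Scope ring_scope.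
Variables (R : realType) (d : measure_display) (T : measurableType d).
Variables (P : probability T R).

Lemma expectation_finite (S : finType) (X : T -> S) (F : S -> R) :
  (forall s, measurable [set w | X w = s]) -> (forall s, 0 <= F s) ->
  fine (expectation P (fun w => F (X w))) =
  \sum_s F s * fine (P [set w | X w = s]).
Proof.
move=> mX F0; rewrite unlock.
have -> : (\int[P]_w (F (X w))%:E)%E =
    (\int[P]_w (\sum_s (F s)%:E * (\1_[set w | X w = s] w)%:E))%E.
  apply: eq_integral => w _; rewrite (bigD1 (X w)) //= big1 => [|s sX].
    by rewrite adde0 indicE mem_set ?mule1.
  by rewrite indicE memNset ?mule0 //= => e; rewrite e eqxx in sX.
rewrite ge0_integral_sum //; last 2 first.
- move=> s; apply: emeasurable_funM; first exact: measurable_cst.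
  by apply/measurable_EFinP; exact: measurable_indic.
- by move=> s w _; rewrite mule_ge0 // lee_fin.
rewrite (eq_bigr (fun s => (F s * fine (P [set w | X w = s]))%:E)) ?sumEFin //.
move=> s _; rewrite ge0_integralZl_EFin //; last first.
  by apply/measurable_EFinP; exact: measurable_indic.
by rewrite integral_indic // setIT EFinM fineK // fin_num_measure.
Qed.

End InterchangeExpectation.

Section Combine.
Variables (R : realType) (n : nat).

Lemma sum_edges (V : nmodType) (F : 'S_n -> V) :
  \sum_x \sum_(y | y != x) F (tperm x y) = (\sum_(e : edge n) F (transposition e)) *+ 2.
Proof.
have lt_sum : \sum_(p : 'I_n * 'I_n | (p.1 < p.2)%N) F (tperm p.1 p.2) =
    \sum_(e : edge n) F (transposition e).
  rewrite (reindex_omap (val : edge n -> 'I_n * 'I_n) insub) /=.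
    by apply: eq_big => [e|e _ //]; rewrite (valP e) valK eqxx.
  by move=> p pP; rewrite insubT.
rewrite pair_big_dep /= (bigID (fun p : 'I_n * 'I_n => (p.1 < p.2)%N)) /= mulr2n.
congr (_ + _).
  rewrite -lt_sum; apply: eq_bigl => p; rewrite andbC andb_idr // => pp.
  by rewrite neq_ltn pp orbT.
rewrite -lt_sum (reindex (fun p : 'I_n * 'I_n => (p.2, p.1))) /=; last first.
  by exists (fun p : 'I_n * 'I_n => (p.2, p.1)) => -[].
apply: eq_big => [p|p _]; last by rewrite tpermC.
by rewrite -leqNgt ltn_neqAle.
Qed.

Lemma card_edge : (#|{: edge n}|%:R : R) *+ 2 = n%:R * (n%:R - 1).
Proof.
have := sum_edges (fun=> 1 : R); rewrite sumr_const => <-.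
rewrite (eq_bigr (fun=> n%:R - 1)) ?sumr_const ?card_ord ?mulr_natl // => x _.
rewrite sumr_const (cardC1 x) card_ord -subn1 natrB //.
exact: leq_trans (ltn_ord x).
Qed.

Lemma sum_alpha (G : nat -> R) (s : 'S_n) :
  \sum_(1 <= k < n.+1) G k * (alpha_ k s)%:R = \sum_(C in porbits s) G #|C|.
Proof.
have aE k : (alpha_ k s)%:R = \sum_(C in porbits s) (#|C| == k)%:R :> R.
  rewrite /alpha_ -sum1_card natr_sum [RHS](bigID (fun C : {set 'I_n} => #|C| == k)) /=.
  rewrite [X in _ + X]big1 ?addr0 => [|C /andP[_ /negbTE -> //]].
  by apply: eq_big => [C|C]; rewrite inE // => /andP[_ ->].
under eq_bigr do rewrite aE mulr_sumr.
rewrite exchange_big; apply: eq_bigr => C CP /=.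
have Cn : (#|C| <= n)%N by rewrite -[X in (_ <= X)%N]card_ord max_card.
rewrite (bigD1_seq #|C|) ?mem_index_iota ?iota_uniq //=; last first.
  by rewrite (card_porbits_gt0 CP) ltnS.
rewrite eqxx mulr1 big1 ?addr0 // => k /negbTE Ck.
by rewrite eq_sym Ck mulr0.
Qed.

Lemma alphaE (s : 'S_n) : alpha s = #|porbits s|.
Proof.
apply/eqP; rewrite -(eqr_nat R) /alpha natr_sum; apply/eqP.
under eq_bigr do rewrite -[_%:R]mul1r.
by rewrite (sum_alpha (fun=> 1)) sumr_const.
Qed.

Lemma sum_natr_alpha (s : 'S_n) :
  \sum_(1 <= k < n.+1) k%:R * (alpha_ k s)%:R = n%:R :> R.
Proof.
by rewrite (sum_alpha (fun k => k%:R)) -natr_sum sum_card_porbits card_ord.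
Qed.

End Combine.

(** * Expected cycle counts and the final ratio *)

Section MainFormula.
Local Open Scope classical_set_scope.
Local Open Scope ring_scope.
Variables (R : realType) (d : measure_display) (T : measurableType d).
Variables (P : probability T R) (n : nat).
Variables (N : edge n -> R -> T -> nat) (pi : R -> T -> 'S_n).
Hypothesis driven : driven_by_clocks P N pi.
Variable t : R.
Hypothesis t0 : 0 <= t.
Let prob (s : 'S_n) : R := fine (P [set w | pi t w = s]).

(* The coefficient of ['X^j] in [reduced_alternant] is an eigenfunction of the generator
   with eigenvalue affine in [j], so running the process rescales ['X]. *)
Lemma expectation_reduced_alternant a b k : (a + b + k.+1 = n)%N ->
  let y := expR (- (t * k.+1%:R)) in
  \sum_s (reduced_alternant R s a.+1 b).[1] * prob s =
  expR (- (t * (a * b + b)%N%:R)) * (y ^+ n.+1 * (reduced_alternant R (1 : 'S_n)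
      a.+1 b).[y^-1]).
Proof.
move=> abk y; pose F (s : 'S_n) := reduced_alternant R s a.+1 b.
pose c : R := (n%:R + 1) * (n%:R - 2 * k.+1%:R) - 2 * n%:R - 2 * (a.+1%:R * b%:R).
have eig j (s : 'S_n) : \sum_e (F (s * transposition e)%g)`_j =
    ((c + 2 * k.+1%:R * j%:R) / 2) * (F s)`_j.
  have abk' : (a.+1 + b + k.+1 = #|'I_n|.+1)%N by rewrite card_ord -abk; lia.
  have := reduced_alternant_laplacian R s abk' isT; rewrite card_ord => lap.
  have {lap} := congr1 (fun p : {poly R} => p`_j) lap.
  rewrite (sum_edges (fun r => F (s * r)%g)) coefMn coef_sum.
  have -> : (n%:R + 1) * (n%:R - 2 * k.+1%:R) - 2 * n%:R - 2 * (a.+1%:R * b%:R) =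
      c%:P :> {poly R}.
    by rewrite /c !(rmorphB, rmorphM, rmorphD, rmorph_nat, rmorph1).
  have -> : 2 * k.+1%:R = (2 * k.+1%:R)%:P :> {poly R} by rewrite rmorphM !rmorph_nat.
  have XD : ('X * (F s)^`())`_j = j%:R * (F s)`_j.
    by rewrite coefXM; case: j => [|j] /=; rewrite ?mul0r // coef_deriv mulr_natl.
  rewrite coefD !coefCM XD -/(F s) => h.
  (* Ordered pairs count every edge twice, whence the 2 in the eigenvalue. *)
  apply: (@mulIf _ 2) => //; rewrite mulr_natr h.
  by field.
(* A common bound on the sizes lets all permutations share one range of exponents. *)
pose M := (\max_s size (F s))%N.
have hornerM s x : (F s).[x] = \sum_(j < M) (F s)`_j * x ^+ j.
  by apply: horner_coef_wide; exact: (leq_bigmax (F := fun s => size (F s))).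
(* As [n = a + b + k.+1], the coefficient of [t] is [- (a * b + b) - k.+1 * (n + 1) + k.+1 * j]. *)
have expE j : expR (((c + 2 * k.+1%:R * j%:R) / 2 - #|{: edge n}|%:R) * t) =
    expR (- (t * (a * b + b)%N%:R)) * y ^+ n.+1 * y^-1 ^+ j.
  have yE m : y ^+ m = expR (- (t * k.+1%:R * m%:R)) by rewrite /y -expRM_natr mulNr.
  rewrite exprVn !yE -expRN -!expRD; congr expR.
  have EE : #|{: edge n}|%:R = n%:R * (n%:R - 1) / 2 :> R.
    by rewrite -card_edge -[_ *+ 2]mulr_natr mulfK.
  rewrite EE /c natrD natrM -(natr1 n).
  have -> : n%:R = a%:R + b%:R + k.+1%:R :> R by rewrite -!natrD abk.
  by rewrite -(natr1 a); field.
transitivity (\sum_(j < M) \sum_s (F s)`_j * prob s).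
  rewrite exchange_big; apply: eq_bigr => s _ /=; rewrite -/(F s) hornerM.
  by rewrite mulr_suml; apply: eq_bigr => j _; rewrite expr1n mulr1.
under eq_bigr => j _ do rewrite (interchange_eigenfunction driven t0 (eig j)) expE.
rewrite -/(F 1%g) hornerM !mulr_sumr; apply: eq_bigr => j _.
by ring.
Qed.

(** The factor 2 is the weight of the marked [k]-cycle, since the reduced alternants only weight the
    other cycles. *)
Lemma expectation_cycles k : (0 < k <= n)%N ->
  \sum_s (k%:R * (alpha_ k s)%:R * 2 ^+ alpha s) * prob s =
  2 * \sum_(0 <= b < ((n - k)./2).+1) psi n b k t.
Proof.
case: k => // k /andP[_ kn].
have kn' : (0 < k.+1 <= #|'I_n|)%N by rewrite card_ord.
transitivity (2 * \sum_s (\sum_(0 <= b < ((n - k.+1)./2).+1) (n - k.+1 - b.*2).+1%:R *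
    (reduced_alternant R s (n - k.+1 - b).+1 b).[1]) * prob s).
  rewrite mulr_sumr; apply: eq_bigr => s _.
  have := sum_reduced_alternant_at1 R s kn'; rewrite card_ord => ->.
  have pos : (0 < #|porbits s|)%N.
    rewrite card_gt0; apply/finset.set0Pn.
    by exists (porbit s (Ordinal kn)); exact: mem_porbits.
  have e2 : 2 ^+ #|porbits s| = 2 * 2 ^+ #|porbits s|.-1 :> R by rewrite -exprS prednK.
  rewrite (_ : #|[set C in porbits s | #|C| == k.+1]%SET| = alpha_ k.+1 s) //.
  rewrite (alphaE R) e2.
  move: (alpha_ _ _)%:R (2 ^+ _) (prob s) => u v w.
  by ring.
congr (2 * _); under eq_bigr => s _ do rewrite mulr_suml.
rewrite exchange_big /=; apply: eq_big_nat => b /andP[_ bn].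
have abk : ((n - k.+1 - b) + b + k.+1 = n)%N by lia.
under eq_bigr => s _ do rewrite -mulrA.
rewrite -mulr_sumr (expectation_reduced_alternant abk).
have abk' : ((n - k.+1 - b) + b + k.+1 = #|'I_n|)%N by rewrite card_ord.
have := psi_reduced_alternant abk' t0; rewrite card_ord => ->.
rewrite mulrA; congr (_ * _ * _).
(* With [a = d - b], where [d = n - k.+1], the weight [d - 2b + 1] is the prefactor [a + 1 - b] of
   [psi]. *)
have -> : (n - k.+1 - b = (n - k.+1 - b.*2) + b)%N by lia.
by rewrite -natr1 natrD; ring.
Qed.

End MainFormula.

Theorem theorem2 (R : realType) (d : measure_display) (T : measurableType d)
    (P : probability T R) (n : nat) (hn : (1 <= n)%N) (t : R) (ht : 0 <= t)
    (pi : R -> T -> 'S_n) (hpi : interchange_process P pi) :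
  m2 P pi t =
    n%:R *
    ((\sum_(1 <= k < n.+1) \sum_(0 <= b < ((n - k)./2).+1) k%:R * psi n b k t)
     / (\sum_(1 <= k < n.+1) \sum_(0 <= b < ((n - k)./2).+1) psi n b k t)).
Proof.
case: hpi => N driven; rewrite /m2.
have mpi s : measurable [set w | pi t w = s]%classic by exact: (pi_measurable driven).
rewrite (expectation_finite P mpi
  (F := fun s : 'S_n => (\sum_(1 <= k < n.+1) k%:R ^+ 2 * (alpha_ k s)%:R) * 2 ^+
      alpha s));
  last first.
  move=> s; rewrite mulr_ge0 ?exprn_ge0 //; apply: sumr_ge0 => k _.
  by rewrite mulr_ge0 ?exprn_ge0.
rewrite (expectation_finite P mpi (F := fun s : 'S_n => 2 ^+ alpha s)); last first.
  by move=> s; rewrite exprn_ge0.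
set prob := fun s => fine (P [set w | pi t w = s]%classic).
set S := fun k => \sum_(0 <= b < ((n - k)./2).+1) psi n b k t.
have cycles k : (1 <= k < n.+1)%N ->
    \sum_s (k%:R * (alpha_ k s)%:R * 2 ^+ alpha s) * prob s = 2 * S k.
  by rewrite ltnS => kn; exact: (expectation_cycles driven ht kn).
have -> : \sum_s (\sum_(1 <= k < n.+1) k%:R ^+ 2 * (alpha_ k s)%:R) * 2 ^+ alpha s
    * prob s =
    2 * \sum_(1 <= k < n.+1) \sum_(0 <= b < ((n - k)./2).+1) k%:R * psi n b k t.
  under eq_bigr do rewrite !mulr_suml.
  rewrite exchange_big mulr_sumr /=; apply: eq_big_nat => k kn.
  rewrite -mulr_sumr -/(S k) mulrCA -cycles // mulr_sumr.
  by apply: eq_bigr => s _; rewrite expr2 !mulrA.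
(* As cycle lengths add up to [n], the expectations over all [k] sum to [n] times the
   denominator. *)
have denE : n%:R * \sum_s 2 ^+ alpha s * prob s = 2 * \sum_(1 <= k < n.+1) S k.
  rewrite [RHS]mulr_sumr -(eq_big_nat _ _ cycles) exchange_big mulr_sumr /=.
  apply: eq_bigr => s _; rewrite -(sum_natr_alpha R s) mulr_suml.
  by apply: eq_bigr => k _; rewrite !mulrA.
have n0 : n%:R != 0 :> R by rewrite pnatr_eq0 -lt0n.
have -> : \sum_s 2 ^+ alpha s * prob s = 2 * (\sum_(1 <= k < n.+1) S k) / n%:R.
  by rewrite -denE mulrC mulKf.
rewrite -[X in _ = _ * (_ / X)]/(\sum_(1 <= k < n.+1) S k) !invfM invrK.
have n2 : 2 != 0 :> R by [].
move: (\sum_(1 <= k < n.+1) S k)^-1 => v.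
move: (\sum_(1 <= k < _) _) => u.
by field.
Qed.
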